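(* For each integer $n\ge 1$ there is a constant $C(n)>0$ such that the following holds. Let $1\le k\le n$, let $R$ be an $n$-dimensional rectangle with dimensions $R_1\le\dots\le R_n$, and let $S$ be an $n$-dimensional rectangle with dimensions $S_1\le\dots\le S_n$. If for all integers $j,l$ with $0\le j<k\le l\le n$, $$ (R_1\cdots R_j)^{\frac{l-j}{k-j}}\, R_{j+1}\cdots R_l \;\ge\; C(n)\,(S_1\cdots S_j)^{\frac{l-j}{k-j}}\, S_{j+1}\cdots S_l ,$$ then there is a $k$-expanding embedding from $S$ into $R$.
   Context: An $n$-dimensional rectangle with dimensions $R_1\le\dots\le R_n$ (all positive) is the open set $(0,R_1)\times\dots\times(0,R_n)\subset\mathbb{R}^n$ with the Euclidean metric. For open sets $U,V\subset\mathbb{R}^n$, a (smooth) embedding $I:V\to U$ is called $k$-expanding if for every $k$-dimensional surface $\Sigma\subset V$ the $k$-dimensional volume of $I(\Sigma)$ is at least the $k$-dimensional volume of $\Sigma$. Empty products (case $j=0$) equal $1$. *)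

(* Defs.v *)
From HB Require Import structures.
From mathcomp Require Import all_boot all_order all_algebra.
From mathcomp Require Import all_classical all_reals all_analysis.
Import Order.TTheory GRing.Theory Num.Theory.
Import numFieldNormedType.Exports.

Set Implicit Arguments.
Unset Strict Implicit.
Unset Printing Implicit Defensive.

Local Open Scope classical_set_scope.
Local Open Scope ring_scope.

Section lebesgue_tuple.
Context (K : realType).
Local Notation tup k := (k.-tuple (measurableTypeR K)).

Definition cons_pair k (p : measurableTypeR K * tup k) : tup k.+1 :=
  [tuple of p.1 :: p.2].

Lemma measurable_cons_pair k : measurable_fun setT (@cons_pair k).
Proof. exact: measurable_cons. Qed.

Definition lebesgue_cons k (mu : {sigma_finite_measure set (tup k) -> \bar K})
    : set (tup k.+1) -> \bar K :=
  pushforward (lebesgue_measure \x mu)%E (@cons_pair k).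

Section lebesgue_cons_measure.
Context (k : nat) (mu : {sigma_finite_measure set (tup k) -> \bar K}).

Let m : {measure set (tup k.+1) -> \bar K} :=
  @measure_function_pushforward__canonical__measure_function_Measure
    _ _ _ _ _ (lebesgue_measure \x mu)%E _ (@measurable_cons_pair k).

Let m0 : lebesgue_cons mu set0 = 0%E. Proof. exact: (measure0 m). Qed.

Let m_ge0 A : (0 <= lebesgue_cons mu A)%E. Proof. exact: (measure_ge0 m). Qed.

Let m_sigma_additive : semi_sigma_additive (lebesgue_cons mu).
Proof. exact: (@measure_semi_sigma_additive _ _ _ m). Qed.

HB.instance Definition _ := isMeasure.Build _ _ _
  (lebesgue_cons mu) m0 m_ge0 m_sigma_additive.

Let m_sigma_finite : sigma_finite setT (lebesgue_cons mu).
Proof.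
have /sigma_finiteP[F [TF ndF Foo]] := @sigma_finiteT _ _ _
  (lebesgue_measure : {sigma_finite_measure set (measurableTypeR K) -> \bar K}).
have /sigma_finiteP[G [TG ndG Goo]] := sigma_finiteT mu.
pose uncons (t : tup k.+1) : measurableTypeR K * tup k :=
  (thead t, [tuple of behead t]).
have consK : cancel (@cons_pair k) uncons.
  by move=> [x t]; congr pair; apply: val_inj.
have munc : measurable_fun setT uncons.
  apply: measurable_fun_pair; last exact: measurable_behead.
  exact: measurable_tnth.
exists (fun i => uncons @^-1` (F i `*` G i)).
  apply/esym; rewrite -subTset => t _.
  have : setT (uncons t).1 by []; rewrite TF => -[i _ Fi].
  have : setT (uncons t).2 by []; rewrite TG => -[j _ Gj].
  exists (maxn i j) => //; split.
    by move: Fi; exact/subsetPset/ndF/leq_maxl.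
  by move: Gj; exact/subsetPset/ndG/leq_maxr.
move=> i; have [mF Fi] := Foo i; have [mG Gi] := Goo i; split.
  by rewrite -[X in measurable X]setTI; apply: munc => //; exact: measurableX.
rewrite /lebesgue_cons /pushforward -comp_preimage.
rewrite (_ : uncons \o _ = id); last by apply: funext => p /=; rewrite consK.
by rewrite product_measure1E// lte_mul_pinfty// ge0_fin_numE.
Qed.

HB.instance Definition _ := @Measure_isSigmaFinite.Build _ _ _
  (lebesgue_cons mu) m_sigma_finite.

End lebesgue_cons_measure.

(* k-dimensional Lebesgue measure, as an iterated product measure *)
Fixpoint lebesgue_tuple k : {sigma_finite_measure set (tup k) -> \bar K} :=
  if k is k'.+1 then lebesgue_cons (lebesgue_tuple k')
  else \d_([tuple] : tup 0).

End lebesgue_tuple.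

Section surfaces.
Context (K : realType).

(* C^r on U; only meaningful for open U, where the values of f outside of U
   are irrelevant. *)
Fixpoint Cr_on m n (r : nat) (U : set 'rV[K]_m) (f : 'rV[K]_m -> 'rV[K]_n)
    : Prop :=
  if r is r'.+1 then
    (forall x, U x -> differentiable f x) /\
    (forall v, Cr_on r' U ('D_v f))
  else forall x, U x -> {for x, continuous f}.

Definition smooth_on m n (U : set 'rV[K]_m) (f : 'rV[K]_m -> 'rV[K]_n) : Prop :=
  forall r, Cr_on r U f.

(* The last clause says that f is a homeomorphism from U onto f @` U. *)
Definition smooth_embedding m n (U : set 'rV[K]_m)
    (f : 'rV[K]_m -> 'rV[K]_n) : Prop :=
  [/\ smooth_on U f,
      forall x, U x -> row_free ('J f x),
      {in U &, injective f} &
      forall A, open A -> A `<=` U ->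
        exists2 B, open B & f @` A = B `&` f @` U].

(* k-dimensional embedded submanifolds of R^n, not necessarily closed *)
Definition smooth_surface k n (Sigma : set 'rV[K]_n) : Prop :=
  forall p, Sigma p ->
    exists (U : set 'rV[K]_k) (f : 'rV[K]_k -> 'rV[K]_n) (W : set 'rV[K]_n),
      [/\ open U, smooth_embedding U f, open W, W p & f @` U = Sigma `&` W].

Definition row_of_tuple k (t : k.-tuple (measurableTypeR K)) : 'rV[K]_k :=
  \row_i tnth t i.

(* The square root of the Gram determinant of the partial derivatives of f for
   the Euclidean inner product ('J f x acts on row vectors). *)
Definition area_density k n (f : 'rV[K]_k -> 'rV[K]_n) (x : 'rV[K]_k) : K :=
  Num.sqrt (\det ('J f x *m ('J f x)^T)).

Definition patch_volume k n (U : set 'rV[K]_k) (f : 'rV[K]_k -> 'rV[K]_n)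
    : \bar K :=
  (\int[lebesgue_tuple K k]_(t in @row_of_tuple k @^-1` U)
     (area_density f (row_of_tuple t))%:E)%E.

(* A smooth surface is, up to a set of k-volume zero, a countable disjoint union
   of open parametrized patches; by the change of variables formula its k-volume
   is the supremum of the total volumes of finite families of disjoint patches.
   For a surface with a global parametrization (U, f), this is
   patch_volume U f. *)
Definition surface_volume k n (Sigma : set 'rV[K]_n) : \bar K :=
  ereal_sup [set v | exists (m : nat) (U : 'I_m -> set 'rV[K]_k)
                            (f : 'I_m -> 'rV[K]_k -> 'rV[K]_n),
    [/\ forall i, [/\ open (U i), smooth_embedding (U i) (f i) &
                      f i @` U i `<=` Sigma],
        trivIset setT (fun i => f i @` U i) &
        v = (\sum_(i < m) patch_volume (U i) (f i))%E]].

Definition k_expanding k n (V : set 'rV[K]_n) (I : 'rV[K]_n -> 'rV[K]_n)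
    : Prop :=
  forall Sigma : set 'rV[K]_n, smooth_surface k Sigma -> Sigma `<=` V ->
    (surface_volume k Sigma <= surface_volume k (I @` Sigma))%E.

End surfaces.

Section rectangles.
Context (K : realType) (n : nat).

(* The side lengths are indexed from 0: R i is R_(i+1). *)
Definition rectangle_dims (R : 'I_n -> K) : Prop :=
  (forall i, 0 < R i) /\ (forall i j : 'I_n, (i <= j)%N -> R i <= R j).

Definition rectangle (R : 'I_n -> K) : set 'rV[K]_n :=
  [set x | forall i, 0 < x 0 i < R i].

(* (R_1 ... R_j)^((l-j)/(k-j)) R_(j+1) ... R_l *)
Definition dims_product (R : 'I_n -> K) (k j l : nat) : K :=
  (\prod_(i < n | (i < j)%N) R i) `^ ((l - j)%:R / (k - j)%:R) *
  \prod_(i < n | (j <= i < l)%N) R i.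

End rectangles.

(* Main.v *)
(* The hypothesis says that the piecewise linear interpolation of
   D(i) = log (R_1 ... R_i) - log (S_1 ... S_i) through any j < k <= l is at
   least log C at k.  Hence D lies, up to constants, above a line through (k, 0)
   of some slope log lam >= 0, which means that the box T with sides
   S_1 / lam^(k-1), lam S_2, ..., lam S_n satisfies c T_1 ... T_l <= R_1 ... R_l
   for 1 <= l <= n.  The diagonal map from S to T is k-expanding.

   From T one reaches R by at most n folds, as in the proof that majorization is
   generated by Robin Hood transfers: a fold takes sides T_i < R_i and T_j > R_j
   with i < j, and multiplies T_i and divides T_j by the same factor (up to
   constants), so that one of them reaches its target.  It rolls the (i, j)-face
   up into a spiral around a segment of length comparable to that of the target
   and does not decrease the length of any vector; by the Cauchy-Binet formula,
   it does not decrease k-dimensional volumes either. *)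
Require Import Defs.
From mathcomp Require Import all_boot all_order all_algebra.
From mathcomp Require Import fingroup perm ring lra.
From mathcomp Require Import all_classical all_reals all_analysis.
Import Order.TTheory GRing.Theory Num.Theory.
Import numFieldNormedType.Exports.
Local Open Scope classical_set_scope.
Local Open Scope ring_scope.

Set Implicit Arguments.
Unset Strict Implicit.
Unset Printing Implicit Defensive.

(** * Gram determinants *)

Section gram.
Context (K : realFieldType).

(** Expanding the product of row sums over all choice maps [f] gives an unreduced Cauchy-Binet
    formula: [f] need not be increasing, and a repeated value makes the minor of [B] vanish. *)
Lemma det_mulmx_sum k N (A : 'M[K]_(k, N)) (B : 'M[K]_(N, k)) :
  \det (A *m B) =
  \sum_(f : {ffun 'I_k -> 'I_N}) (\prod_i A i (f i)) * \det (rowsub f B).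
Proof.
under [RHS]eq_bigr do rewrite mulr_sumr.
rewrite exchange_big; apply: eq_bigr => s _ /=.
under eq_bigr do rewrite mxE.
rewrite bigA_distr_bigA mulr_sumr /=; apply: eq_bigr => f _.
rewrite mulrCA -big_split; congr (_ * _).
by apply: eq_bigr => i _; rewrite mxE.
Qed.

(** Summing over all maps counts each set of k columns [k!] times, which gives Cauchy-Binet for Gram
    determinants without choosing subsets. *)
Lemma fact_det_gram k N (A : 'M[K]_(k, N)) :
  (k`!)%:R * \det (A *m A^T) =
  \sum_(f : {ffun 'I_k -> 'I_N}) \det (colsub f A) ^+ 2.
Proof.
(* Precomposing [f] with [s] permutes the rows of the minor and produces the sign of [s]; summing
   over [s] then assembles the second copy of the minor. *)
have H (s : 'S_k) : \det (A *m A^T) = \sum_(f : {ffun 'I_k -> 'I_N})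
    ((-1) ^+ s * \prod_i A i (f (s i))) * \det (colsub f A).
  rewrite det_mulmx_sum.
  rewrite (reindex_onto (fun f : {ffun 'I_k -> 'I_N} => [ffun i => f (s i)])
     (fun f : {ffun 'I_k -> 'I_N} => [ffun i => f (s^-1%g i)])) /=; last first.
    by move=> f _; apply/ffunP => i; rewrite !ffunE permK.
  rewrite big_mkcond /=; apply: eq_bigr => f _.
  have -> : [ffun i => [ffun i0 => f (s i0)] (s^-1%g i)] == f.
    by apply/eqP/ffunP => i; rewrite !ffunE permKV.
  under eq_bigr do rewrite ffunE.
  rewrite mulrAC mulrC; congr (_ * _).
  rewrite -det_tr.
  have -> : (rowsub [ffun i => f (s i)] A^T)^T = colsub f A *m perm_mx s^-1.
    rewrite -col_permE; apply/matrixP => i j; rewrite !mxE ffunE //.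
  by rewrite det_mulmx det_perm odd_permV mulrC.
transitivity (\sum_(s : 'S_k) \det (A *m A^T)).
  by rewrite sumr_const card_Sn mulr_natl.
rewrite (eq_bigr _ (fun s _ => H s)).
rewrite exchange_big; apply: eq_bigr => f _ /=.
rewrite -mulr_suml expr2; congr (_ * _).
apply: eq_bigr => s _; congr (_ * _); apply: eq_bigr => i _.
by rewrite mxE.
Qed.

(** Jacobian matrices act on row vectors, so [J] stands for the Jacobian of a parametrized k-surface
    and [J *m M] for that of its image; the two sides are squared volume densities. *)
Definition expanding_mx k n (M : 'M[K]_n) := forall J : 'M[K]_(k, n),
  \det (J *m J^T) <= \det (J *m M *m (J *m M)^T).

Lemma expanding_mxM k n (M N : 'M[K]_n) :
  expanding_mx k M -> expanding_mx k N -> expanding_mx k (M *m N).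
Proof. by move=> hM hN J; rewrite (le_trans (hM J))// mulmxA hN. Qed.

(** Each minor of [J] on distinct columns is multiplied by the product of the corresponding k
    entries of [d]; minors with a repeated column are zero. *)
Lemma expanding_diag_mx k n (d : 'rV[K]_n) :
  (forall f : 'I_k -> 'I_n, injective f -> 1 <= `|\prod_i d 0 (f i)|) ->
  expanding_mx k (diag_mx d).
Proof.
move=> hd J.
have k0 : 0 < (k`!)%:R :> K by rewrite ltr0n fact_gt0.
rewrite -(ler_pM2l k0) !fact_det_gram; apply: ler_sum => f _.
have -> : colsub f (J *m diag_mx d) = colsub f J *m diag_mx (\row_i d 0 (f i)).
  by apply/matrixP => i j; rewrite !mul_mx_diag !mxE.
rewrite det_mulmx det_diag exprMn.
have [/injectiveP fI|/injectivePn[i [j ij fij]]] := boolP (injectiveb f).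
  rewrite ler_peMr ?sqr_ge0//.
  under eq_bigr do rewrite mxE.
  by rewrite -real_normK ?num_real// exprn_ege1// hd.
rewrite -det_tr (determinant_alternate ij) ?expr0n ?mul0r// => l.
by rewrite !mxE fij.
Qed.

(** The matrices [J *m M] and [row_mx J (J *m B)] have the same Gram matrix, and the minors of the
    latter include all minors of [J]. The hypothesis exhibits [M *m M^T - 1] as positive
    semidefinite. *)
Lemma expanding_gram k n p (M : 'M[K]_n) (B : 'M[K]_(n, p)) :
  M *m M^T = 1%:M + B *m B^T -> expanding_mx k M.
Proof.
move=> hM J.
have -> : J *m M *m (J *m M)^T = row_mx J (J *m B) *m (row_mx J (J *m B))^T.
  rewrite tr_row_mx mul_row_col !trmx_mul mulmxA -[J *m M *m _]mulmxA hM.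
  by rewrite mulmxDr mulmxDl mulmx1 !mulmxA.
have k0 : 0 < (k`!)%:R :> K by rewrite ltr0n fact_gt0.
rewrite -(ler_pM2l k0) !fact_det_gram.
pose h (f : {ffun 'I_k -> 'I_n}) : {ffun 'I_k -> 'I_(n + p)} :=
  [ffun i => lshift p (f i)].
have hI : injective h.
  by move=> f g /ffunP fg; apply/ffunP => i; move: (fg i); rewrite !ffunE => /lshift_inj.
rewrite [leRHS](bigID (mem (h @: finset.setT))) /= big_imset/=; last by move=> ? ? _ _ /hI.
rewrite ler_wpDr ?sumr_ge0// => [f _|]; first by rewrite sqr_ge0.
rewrite big_mkcond/= [leRHS]big_mkcond/=.
rewrite le_eqVlt; apply/orP; left; apply/eqP.
apply: eq_bigr => f _; rewrite inE; congr (\det _ ^+ 2).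
by apply/matrixP => i j; rewrite !mxE ffunE; case: split_ordP => l; [move/lshift_inj-> | move/eqP; rewrite eq_lrshift].
Qed.

End gram.

(** * Smooth maps *)

Section Cr.
Context (K : realType).

(* [Cr_on] for an arbitrary codomain, so that it applies to the coordinates *)
Fixpoint Cr (V W : normedModType K) (r : nat) (U : set V) (f : V -> W) : Prop :=
  if r is r'.+1 then
    (forall x, U x -> differentiable f x) /\ (forall v, Cr r' U ('D_v f))
  else forall x, U x -> {for x, continuous f}.

Lemma Cr_onE m n r (U : set 'rV[K]_m) (f : 'rV[K]_m -> 'rV[K]_n) :
  Cr_on r U f = Cr r U f.
Proof.
elim: r f => [//|r IH] f /=; congr (_ /\ _).
by apply: eq_forall => v; rewrite IH.
Qed.


Lemma is_derive_comp1 (V : normedModType K) (phi : K -> K)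
    (f : V -> K) (x v : V) (p df : K) :
  differentiable f x -> 'D_v f x = df -> is_derive (f x) 1 phi p ->
  is_derive x v (phi \o f) (p * df).
Proof.
move=> dfx <- [dp1 dp2].
have dpx : differentiable phi (f x) by exact/derivable1_diffP.
have dpf : differentiable (phi \o f) x by exact: differentiable_comp.
apply: DeriveDef; first exact: diff_derivable.
rewrite deriveE; last exact: dpf.
have EE := diff_comp dfx dpx.
rewrite EE /= (deriveE v dfx).
have -> : 'd phi (f x) ('d f x v) = 'd f x v *: derive1 phi (f x).
  by have -> := deriv1E dp1.
by rewrite derive1E dp2 mulrC.
Qed.

Lemma differentiable_near_eq (V W : normedModType K) (f g : V -> W) (x : V) :
  {near x, f =1 g} -> differentiable f x -> differentiable g x.
Proof.
move=> fg df.
have go : g \o shift x = cst (g x) + 'd f x +o_ 0 id.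
  apply/eqaddoP => e e0.
  have /eqaddoP/(_ e e0) := diff_locally df.
  have : \forall y \near 0, (f \o shift x) y = (g \o shift x) y.
    pose P y := f y = g y.
    have : \near x, P x by exact: fg.
    by rewrite (near_shift 0 x P) subr0.
  rewrite -(nbhs_singleton fg).
  apply: filterS2 => y fgy.
  by rewrite -[X in `|X| <= _ -> _]/((f \o shift x) y - (cst (f x) + 'd f x) y) fgy.
have cdf := diff_continuous df.
have dg := diff_unique cdf go.
by apply/diff_locallyP; rewrite dg.
Qed.

Section domain.
Context (V : normedModType K) (U : set V) (openU : open U).

Lemma Cr_sub (W : normedModType K) r (U' : set V) (f : V -> W) :
  U' `<=` U -> Cr r U f -> Cr r U' f.
Proof.
move=> U'U; elim: r f => [|r IH] f /= => [h x /U'U/h//|[h1 h2]].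
by split => [x /U'U/h1//|v]; apply: IH.
Qed.

Lemma Cr_pred (W : normedModType K) r (f : V -> W) : Cr r.+1 U f -> Cr r U f.
Proof.
elim: r f => [|r IH] f [h1 h2].
  by move=> x /h1; exact: differentiable_continuous.
by split => // v; apply: IH.
Qed.

Lemma near_ext T (f g : V -> T) x : U x -> {in U, f =1 g} -> {near x, f =1 g}.
Proof.
move=> Ux fg; near=> y; apply: fg; apply/mem_set.
near: y; exact: open_nbhs_nbhs.
Unshelve. all: by end_near. Qed.

Lemma Cr_ext (W : normedModType K) r (f g : V -> W) :
  {in U, f =1 g} -> Cr r U f -> Cr r U g.
Proof.
elim: r f g => [|r IH] f g fg /=.
  move=> cf x Ux; have := cf x Ux; rewrite /prop_for/continuous_at.
  rewrite -(fg x (mem_set Ux)) => h; apply: cvg_trans h.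
  apply: near_eq_cvg; exact: near_ext.
move=> [df h]; split => [x Ux|v].
  exact: differentiable_near_eq (near_ext Ux fg) (df x Ux).
apply: IH (h v) => x /set_mem Ux.
by apply: near_eq_derive; exact: near_ext.
Qed.

Lemma Cr_cst (W : normedModType K) r (c : W) : Cr r U (cst c).
Proof.
elim: r c => [|r IH] c /=; first by move=> x _; exact: cvg_cst.
split => // v; apply: Cr_ext (IH 0) => x _; by rewrite derive_cst.
Qed.

Lemma Cr_linear (W : normedModType K) r (f : {linear V -> W}) :
  continuous f -> Cr r U f.
Proof.
move=> cf; case: r => [|r]; first by move=> x _; exact: cf.
split => [x _|v]; first exact: linear_differentiable.
apply: Cr_ext (Cr_cst r (f v)) => x _.
by rewrite deriveE ?diff_lin//; exact: linear_differentiable.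
Qed.

Lemma CrD (W : normedModType K) r (f g : V -> W) :
  Cr r U f -> Cr r U g -> Cr r U (fun x => f x + g x).
Proof.
elim: r f g => [|r IH] f g /=.
  by move=> cf cg x Ux; apply: cvgD; [exact: cf|exact: cg].
move=> [df hf] [dg hg]; split => [x Ux|v].
  by apply: differentiableD; [exact: df|exact: dg].
apply: Cr_ext (IH _ _ (hf v) (hg v)) => x /set_mem Ux.
by rewrite deriveD//; apply: diff_derivable; [exact: df|exact: dg].
Qed.

Lemma Cr_sum (W : normedModType K) r (I : finType) (f : I -> V -> W) :
  (forall i, Cr r U (f i)) -> Cr r U (fun x => \sum_i f i x).
Proof.
move=> h; elim: (index_enum I) => [|i s IH].
  by apply: Cr_ext (Cr_cst r 0) => x _; rewrite big_nil.
by apply: Cr_ext (CrD (h i) IH) => x _; rewrite big_cons.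
Qed.

Lemma CrM r (f g : V -> K) :
  Cr r U f -> Cr r U g -> Cr r U (fun x => f x * g x).
Proof.
elim: r f g => [|r IH] f g.
  by move=> cf cg x Ux; apply: cvgM; [exact: cf|exact: cg].
move=> hf hg; have [hf' hg'] := (Cr_pred hf, Cr_pred hg).
move: hf hg => [df hf] [dg hg]; split => [x Ux|v].
  by apply: differentiableM; [exact: df|exact: dg].
apply: Cr_ext (CrD (IH _ _ hf' (hg v)) (IH _ _ hg' (hf v))) => x /set_mem Ux.
by rewrite deriveM//; apply: diff_derivable; [exact: df|exact: dg].
Qed.

(** The derivative along [v] is ['D_v f] times [phi' \o f], so [phi'] is only required at order [r].
    Orders can thus be climbed one at a time when [phi'] is built from functions already treated. *)
Lemma Cr_comp1 r (phi phi' : K -> K) (f : V -> K) :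
  (forall x, U x -> is_derive (f x) 1 phi (phi' (f x))) ->
  Cr r U (phi' \o f) -> Cr r.+1 U f -> Cr r.+1 U (phi \o f).
Proof.
move=> dphi hphi' hf; have hf' := Cr_pred hf; case: hf => df hf.
have dphif x : U x -> differentiable phi (f x).
  by move=> Ux; apply/derivable1_diffP; have [] := dphi x Ux.
split => [x Ux|v].
  by apply: differentiable_comp; [exact: df|exact: dphif].
apply: Cr_ext (CrM (hf v) hphi') => x /set_mem Ux.
have [_ ->] := is_derive_comp1 (df x Ux) (erefl ('D_v f x)) (dphi x Ux).
by rewrite mulrC.
Qed.

Lemma Cr0_comp1 (phi phi' : K -> K) (f : V -> K) :
  (forall x, U x -> is_derive (f x) 1 phi (phi' (f x))) ->
  Cr 0 U f -> Cr 0 U (phi \o f).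
Proof.
move=> dphi hf x Ux; apply: continuous_comp; first exact: hf.
apply: differentiable_continuous; apply/derivable1_diffP.
by have [] := dphi x Ux.
Qed.

Lemma CrV r (f : V -> K) : (forall x, U x -> f x != 0) ->
  Cr r U f -> Cr r U (fun x => (f x)^-1).
Proof.
move=> f0.
elim: r => [|r IH] hf.
  by move=> x Ux; apply: cvgV; [exact: f0|exact: hf].
have h := IH (Cr_pred hf); case: hf => df hf; split => [x Ux|v].
  by apply: differentiableV; [exact: df|exact: f0].
have hN1 : Cr r U (cst (- 1 : K)) := Cr_cst r _.
have hh := CrM hN1 (CrM (CrM h h) (hf v)).
apply: (Cr_ext _ hh) => x /set_mem Ux /=.
have dfv : derivable f x v by apply/diff_derivable/df.
have fx0 := f0 x Ux.
rewrite deriveV//.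
rewrite mulN1r expr2 invfM; exact/esym/mulNr.
Qed.

End domain.
End Cr.

Section Cr_rV.
Context (K : realType).

Lemma Cr_mx (V : normedModType K) n r (U : set V) (f : V -> 'rV[K]_n) :
  open U -> (forall i, Cr r U (fun x => f x 0 i)) -> Cr r U f.
Proof.
move=> openU.
elim: r f => [|r IH] f h.
  move=> x Ux.
  have -> : f = fun x => \sum_i f x 0 i *: delta_mx 0 i.
    by apply/funext => y; rewrite -row_sum_delta.
  apply: cvg_big => [|i _]; first exact: add_continuous.
  by apply: cvgZr_tmp; exact: h.
have df x : U x -> differentiable f x.
  move=> Ux.
  have -> : f = \sum_i (fun x => f x 0 i *: delta_mx 0 i).
    by apply/funext => y; rewrite fct_sumE -row_sum_delta.
  apply: differentiable_sum => i; apply: differentiableZl.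
  by have [+ _] := h i; exact.
split => // v; apply: IH => i.
have [_ /(_ v)] := h i; apply: Cr_ext => // x /set_mem Ux.
by rewrite derive_mx ?mxE//; exact/diff_derivable/df.
Qed.

Lemma Cr_coord (V : normedModType K) n r (U : set V) (f : V -> 'rV[K]_n) i :
  open U -> Cr r U f -> Cr r U (fun x => f x 0 i).
Proof.
move=> openU; elim: r f => [|r IH] f.
  move=> cf x Ux; apply: (@continuous_comp _ _ _ f (fun M : 'rV[K]_n => M 0 i)).
    exact: cf.
  exact: coord_continuous.
move=> [df hf]; split => [x Ux|v].
  apply: (@differentiable_comp _ _ _ _ f (fun M : 'rV[K]_n => M 0 i)).
    exact: df.
  exact: differentiable_coord.
apply: Cr_ext (IH _ (hf v)) => // x /set_mem Ux.
by rewrite derive_mx ?mxE//; exact/diff_derivable/df.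
Qed.

Lemma Cr_comp m n p r (U : set 'rV[K]_m) (U' : set 'rV[K]_n)
    (f : 'rV[K]_m -> 'rV[K]_n) (g : 'rV[K]_n -> 'rV[K]_p) :
  open U -> open U' -> f @` U `<=` U' ->
  Cr r U f -> Cr r U' g -> Cr r U (g \o f).
Proof.
move=> openU openU' fU; have fU' x : U x -> U' (f x) by move=> Ux; apply: fU; exists x.
elim: r g => [|r IH] g.
  by move=> cf cg x Ux; apply: continuous_comp; [exact: cf|exact/cg/fU'].
move=> hf [dg hg]; have hf' := Cr_pred hf; case: hf => df hf.
have dgf x : U x -> differentiable (g \o f) x.
  by move=> Ux; apply: differentiable_comp; [exact: df|exact/dg/fU'].
split => // v; apply: Cr_mx => // j.
(* The direction ['D_v f x] varies with [x]; expanding it in the standard basis leaves partial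
   derivatives of [g] in fixed directions, to which the induction hypothesis applies. *)
have H i : Cr r U (fun x => 'D_v f x 0 i * ('D_(delta_mx 0 i) g \o f) x 0 j).
  apply: CrM => //; first exact: Cr_coord (hf v).
  apply: Cr_coord => //; exact: IH (hg _).
apply: Cr_ext (Cr_sum openU H) => // x /set_mem Ux.
have dfx := df _ Ux; have dgfx := dg _ (fU' _ Ux).
have -> : 'D_v (g \o f) x = 'd g (f x) ('D_v f x).
  rewrite (deriveE v (dgf _ Ux)) (deriveE v dfx).
  have EE := diff_comp dfx dgfx.
  by rewrite EE.
rewrite [in RHS](row_sum_delta ('D_v f x)) linear_sum summxE.
by apply: eq_bigr => i _; rewrite linearZ mxE /= (deriveE _ dgfx).
Qed.

Lemma jacobian_comp m n p (f : 'rV[K]_m -> 'rV[K]_n) (g : 'rV[K]_n -> 'rV[K]_p)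
    x : differentiable f x -> differentiable g (f x) ->
  'J (g \o f) x = 'J f x *m 'J g (f x).
Proof.
move=> df dg; apply/row_matrixP => i; rewrite !rowE.
have dgf : differentiable (g \o f) x by exact: differentiable_comp.
rewrite mulmxA -(deriveEjacobian _ dgf) -(deriveEjacobian _ df).
rewrite -(deriveEjacobian _ dg) (deriveE _ dgf) (deriveE _ df) (deriveE _ dg).
have EE := diff_comp df dg.
by rewrite EE.
Qed.

Lemma smooth_embedding_comp m n p (U : set 'rV[K]_m) (U' : set 'rV[K]_n)
    (f : 'rV[K]_m -> 'rV[K]_n) (g : 'rV[K]_n -> 'rV[K]_p) :
  open U -> open U' -> f @` U `<=` U' ->
  smooth_embedding U f -> smooth_embedding U' g -> smooth_embedding U (g \o f).
Proof.
move=> openU openU' fU [sf rf injf ef] [sg rg injg eg].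
have fU' x : U x -> U' (f x) by move=> Ux; apply: fU; exists x.
split.
- move=> r; rewrite Cr_onE; apply: (Cr_comp openU openU' fU).
    by rewrite -Cr_onE.
  by rewrite -Cr_onE.
- move=> x Ux; rewrite jacobian_comp; last 2 first.
    by have [+ _] := sf 1%N; exact.
    by have [+ _] := sg 1%N; exact (fun h => h _ (fU' _ Ux)).
  rewrite /row_free mxrankMfree; first exact: rf.
  exact: rg (fU' _ Ux).
- move=> x y Ux Uy gfxy; apply: injf => //.
  by apply: injg gfxy; apply/mem_set/fU'/set_mem.
(* Relative openness is transported through [f] and then [g]; [B] is cut down to [U'] because [g] is
   an embedding only there. *)
- move=> A openA AU; have [B openB fA] := ef A openA AU.
  have [||B' openB' gB] := eg (B `&` U'); first exact: openI.
    by move=> ? [].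
  exists B' => //; apply/seteqP; split => [_ [x Ax <-]|y [B'y [x Ux gfx]]] /=.
    have : (B `&` f @` U) (f x) by rewrite -fA; exists x.
    move=> [Bfx _]; split; last by exists x => //; exact: AU.
    have : (B' `&` g @` U') (g (f x)).
      by rewrite -gB; exists (f x) => //; split => //; exact/fU'/AU.
    by case.
  rewrite -gfx /= in B'y *.
  have : (B' `&` g @` U') (g (f x)) by split => //; exists (f x) => //; exact: fU'.
  rewrite -gB => -[z [Bz U'z] gz].
  have zE : z = f x by apply: injg => //; apply/mem_set => //; exact: fU'.
  have : (B `&` f @` U) (f x) by split; [rewrite -zE|exists x].
  by rewrite -fA => -[t At <-]; exists t.
Qed.

End Cr_rV.

(** * Volumes of surfaces *)

Section volume.
Context (K : realType).

(* For a nonnegative function, [integral] is by definition a supremum over the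
   simple functions below it, whether or not the function is measurable. *)
Lemma le_integral_ge0 d (T : measurableType d) (mu : {measure set T -> \bar K})
    (D : set T) (f g : T -> \bar K) :
  (forall x, D x -> 0 <= f x)%E -> (forall x, D x -> f x <= g x)%E ->
  (\int[mu]_(x in D) f x <= \int[mu]_(x in D) g x)%E.
Proof.
move=> f0 fg; rewrite /integral.
have f0' x : (0 <= (f \_ D) x)%E by apply: erestrict_ge0.
have fg' x : ((f \_ D) x <= (g \_ D) x)%E.
  by rewrite /patch; case: ifPn => // /set_mem; exact: fg.
have g0' x : (0 <= (g \_ D) x)%E := le_trans (f0' x) (fg' x).
have -> : ((f \_ D)^\-)%E = ((g \_ D)^\-)%E.
  by apply/funext => x; rewrite !(@ge0_funenegE _ _ setT) ?inE.
apply: leeB => //; apply: ereal_sup_le => _ [h hf <-]; exists h => // x.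
apply: le_trans (hf x) _.
by rewrite !(@ge0_funeposE _ _ setT) ?inE.
Qed.

Lemma k_expanding_pointwise k n (V : set 'rV[K]_n) (I : 'rV[K]_n -> 'rV[K]_n) :
  open V -> smooth_embedding V I ->
  (forall x, V x -> expanding_mx k ('J I x)) -> k_expanding k V I.
Proof.
move=> openV eI hI Sigma _ SV; apply: ge_ereal_sup => _ [m [U [f [hf tf ->]]]].
have fUV i : f i @` U i `<=` V.
  by have [_ _ h] := hf i; apply: subset_trans SV.
have sI : forall x, V x -> differentiable I x by case: eI => /(_ 1%N)[].
apply: (@le_trans _ _ (\sum_(i < m) patch_volume (U i) (I \o f i))%E); last first.
  apply: ereal_sup_ubound.
  exists m, U, (fun i => I \o f i); split => //.
    move=> i; have [oU eU fS] := hf i; split => //.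
      exact: smooth_embedding_comp eU eI.
    by move=> _ [x Ux <-]; exists (f i x) => //; apply: fS; exists x.
  move=> i j _ _ [_ [[x Ux <-] [y Uy]]] /= Ixy; apply: (tf i j) => //.
  exists (f i x); split; first by exists x.
  exists y => //; case: eI => _ _ /(_ (f j y) (f i x)) + _; apply => //.
    by apply/mem_set/(fUV j); exists y.
  by apply/mem_set/(fUV i); exists x.
have density_le i t : (@row_of_tuple K k @^-1` U i) t ->
    area_density (f i) (row_of_tuple t) <=
    area_density (I \o f i) (row_of_tuple t).
  move=> Ut; have [_ [sf _ _ _] _] := hf i.
  have Vf : V (f i (row_of_tuple t)) by apply: (fUV i); exists (row_of_tuple t).
  rewrite /area_density jacobian_comp; last 2 first.
  - by have [+ _] := sf 1%N; exact.
  - exact: sI.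
  by rewrite ler_wsqrtr//; exact: hI.
apply: lee_sum => i _.
apply: (@le_integral_ge0 _ _ (lebesgue_tuple K k)) => t Ut.
  rewrite lee_fin; exact: sqrtr_ge0.
rewrite lee_fin; exact: density_le.
Qed.

End volume.

(** * Embeddings of boxes *)

Section embeds.
Context (K : realType).

Lemma open_rectangle n (R : 'I_n -> K) : open (rectangle R).
Proof.
rewrite openE => x Rx; rewrite /interior; near=> y => i; move: i.
near: y; apply: filter_forall => i.
have /andP[x0 xR] := Rx i.
have cx := @coord_continuous K 1 n 0 i x.
near=> y; apply/andP; split; near: y.
  exact: cvgr_gt x0.
exact: cvgr_lt xR.
Unshelve. all: by end_near. Qed.

(** The image of the compact set [C] minus [A] is closed, and by injectivity on [C] its complement
    cuts out exactly [f @] A[from]f @[U]. *)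
Lemma open_embedding_compact m n (U C : set 'rV[K]_m) (f : 'rV[K]_m -> 'rV[K]_n) :
  compact C -> U `<=` C -> continuous f -> {in C &, injective f} ->
  forall A, open A -> A `<=` U -> exists2 B, open B & f @` A = B `&` f @` U.
Proof.
move=> compC UC cf injf A openA AU; exists (~` (f @` (C `&` ~` A))).
  rewrite openC; apply: compact_closed; first exact: norm_hausdorff.
  apply: continuous_compact; first exact: continuous_subspaceT.
  by apply: compact_closedI => //; exact: open_closedC.
apply/seteqP; split => [_ [x Ax <-]|y [By [x Ux fx]]] /=.
  split; last by exists x => //; exact: AU.
  move=> [y [Cy nAy] fyx]; apply: nAy; rewrite (injf y x)// inE//.
  exact/UC/AU.
exists x => //; apply: contrapT => nAx; apply: By; exists x => //.
by split => //; exact: UC.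
Qed.

Lemma compact_closed_box n (R : 'I_n -> K) :
  compact [set x : 'rV[K]_n | forall i, 0 <= x 0 i <= R i].
Proof.
have := @rV_compact K n (fun i => `[0, R i]%classic) (fun i => @segment_compact K _ _).
by congr compact; apply/seteqP; split => x /= h i; have := h i; rewrite in_itv.
Qed.

Lemma smooth_embedding_box n (R : 'I_n -> K) (f : 'rV[K]_n -> 'rV[K]_n) :
  smooth_on setT f -> (forall x, rectangle R x -> 'J f x \in unitmx) ->
  {in [set x : 'rV[K]_n | forall i, 0 <= x 0 i <= R i] &, injective f} ->
  smooth_embedding (rectangle R) f.
Proof.
move=> sf Jf injf.
have RC : rectangle R `<=` [set x : 'rV[K]_n | forall i, 0 <= x 0 i <= R i].
  by move=> x Rx i; have /andP[/ltW-> /ltW->] := Rx i.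
split.
- move=> r; have := sf r; rewrite !Cr_onE; exact: Cr_sub.
- by move=> x Rx; rewrite row_free_unit Jf.
- by move=> x y /set_mem Rx /set_mem Ry; apply: injf; apply/mem_set/RC.
- apply: open_embedding_compact RC _ injf; first exact: compact_closed_box.
  by move=> x; exact: (sf 0%N).
Qed.

(** Expansion is asked of the Jacobian at each point rather than of volumes, so that the relation
    composes by the chain rule. *)
Definition embeds k n (S R : 'I_n -> K) := exists I : 'rV[K]_n -> 'rV[K]_n,
  [/\ smooth_embedding (rectangle S) I,
      I @` rectangle S `<=` rectangle R &
      forall x, rectangle S x -> expanding_mx k ('J I x)].

Lemma embeds_trans k n (S T R : 'I_n -> K) :
  embeds k S T -> embeds k T R -> embeds k S R.
Proof.
move=> [f [ef fST hf]] [g [eg gTR hg]]; exists (g \o f).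
have fT x : rectangle S x -> rectangle T (f x) by move=> Sx; apply: fST; exists x.
split.
- by apply: smooth_embedding_comp fST ef eg; exact: open_rectangle.
- by move=> _ [x Sx <-]; apply: gTR; exists (f x) => //; exact: fT.
- move=> x Sx; rewrite jacobian_comp.
  + by apply: expanding_mxM; [exact: hf|exact/hg/fT].
  + by case: ef => /(_ 1%N)[+ _] _ _ _; exact.
  + by case: eg => /(_ 1%N)[+ _] _ _ _; apply; exact: fT.
Qed.

Lemma embeds_k_expanding k n (S R : 'I_n -> K) : embeds k S R ->
  exists I : 'rV[K]_n -> 'rV[K]_n,
    [/\ smooth_embedding (rectangle S) I,
        I @` rectangle S `<=` rectangle R &
        k_expanding k (rectangle S) I].
Proof.
move=> [I [eI ISR hI]]; exists I; split => //.
by apply: k_expanding_pointwise => //; exact: open_rectangle.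
Qed.

Lemma embeds_diag k n (d S R : 'I_n -> K) :
  (forall i, 0 < d i) -> (forall i, d i * S i <= R i) ->
  (forall f : 'I_k -> 'I_n, injective f -> 1 <= \prod_i d (f i)) ->
  embeds k S R.
Proof.
move=> d0 dSR hd.
pose D := \row_i d i.
pose f : {linear 'rV[K]_n -> 'rV[K]_n} := mulmxr (diag_mx D).
have fE x i : f x 0 i = x 0 i * d i by rewrite /f /= mul_mx_diag !mxE.
have cf : continuous f.
  suff h : Cr 0 setT f by move=> x; exact: h.
  apply: Cr_mx => [|i]; first exact: openT.
  have -> : (fun x : 'rV[K]_n => f x 0 i) = fun x => x 0 i * cst (d i) x.
    by apply/funext => x; rewrite fE.
  apply: CrM; [exact: openT| |exact/Cr_cst/openT].
  by move=> x _; exact: coord_continuous.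
have df x : differentiable f x by exact: linear_differentiable.
have Jf x : 'J f x = diag_mx D.
  apply/row_matrixP => i; rewrite !rowE -(deriveEjacobian _ (df x)).
  by rewrite (deriveE _ (df x)) diff_lin.
exists f; split.
- apply: smooth_embedding_box.
  + move=> r; rewrite Cr_onE; apply: Cr_linear => //; exact: openT.
  + move=> x _; rewrite Jf unitmxE det_diag unitfE; apply/prodf_neq0 => i _.
    by rewrite mxE gt_eqF.
  + move=> x y _ _ /rowP xy; apply/rowP => i; have := xy i; rewrite !fE.
    by apply: mulIf; rewrite gt_eqF.
- move=> _ [x Sx <-] i; rewrite fE; have /andP[x0 xS] := Sx i.
  rewrite mulr_gt0//= mulrC (lt_le_trans _ (dSR i))// ltr_pM2l//.
- move=> x _; rewrite Jf; apply: expanding_diag_mx => g /hd.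
  rewrite ger0_norm; last by apply: prodr_ge0 => i _; rewrite mxE ltW.
  by under [in X in _ -> X]eq_bigr do rewrite mxE.
Qed.

End embeds.

(** * Folding two sides of a box *)

Section Cr_functions.
Context (K : realType) (V : normedModType K) (U : set V) (openU : open U).

(** The two functions are each other's derivative up to sign, hence the joint induction. *)
Lemma Cr_sin_cos r (f : V -> K) : Cr r U f ->
  Cr r U (fun x => sin (f x)) /\ Cr r U (fun x => cos (f x)).
Proof.
elim: r => [|r IH] hf.
  by split; [apply: (Cr0_comp1 (phi' := cos))|apply: (Cr0_comp1 (phi' := -%R \o sin))].
have [hs hc] := IH (Cr_pred hf); split.
  exact: (Cr_comp1 openU (phi := sin) (phi' := cos)).
apply: (Cr_comp1 openU (phi := cos) (phi' := -%R \o sin)) => //.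
have hN1 : Cr r U (cst (- 1 : K)) := Cr_cst openU r _.
by apply: Cr_ext (CrM openU hN1 hs) => // x _; rewrite /= mulN1r.
Qed.

Lemma Cr_sqrt r (f : V -> K) : (forall x, U x -> 0 < f x) ->
  Cr r U f -> Cr r U (fun x => Num.sqrt (f x)).
Proof.
move=> f0; elim: r => [|r IH] hf.
  apply: (Cr0_comp1 (phi' := fun y => (2 * Num.sqrt y)^-1)) => // x Ux.
  exact/is_derive1_sqrt/f0.
apply: (Cr_comp1 openU (phi := Num.sqrt) (phi' := fun y => (2 * Num.sqrt y)^-1)) => //.
  by move=> x Ux; exact/is_derive1_sqrt/f0.
apply: CrV => // [x Ux|].
  by rewrite mulf_neq0 ?pnatr_eq0// gt_eqF// sqrtr_gt0 f0.
by apply: CrM => //; [exact: Cr_cst|exact: IH (Cr_pred hf)].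
Qed.

Lemma Cr_atan r (f : V -> K) : Cr r U f -> Cr r U (fun x => atan (f x)).
Proof.
case: r => [|r] hf.
  by apply: (Cr0_comp1 (phi' := fun y => (1 + y ^+ 2)^-1)).
apply: (Cr_comp1 openU (phi := atan) (phi' := fun y => (1 + y ^+ 2)^-1)) => //.
have h := Cr_pred hf.
apply: CrV => // [x Ux|]; first by rewrite gt_eqF// ltr_pwDl// sqr_ge0.
by apply: CrD => //; [exact: Cr_cst|exact: CrM].
Qed.

End Cr_functions.

(** * Ovals winding around a segment *)

Section oval.
Context (K : realType) (kap : K) (kap0 : 0 < kap) (kap1 : kap < 1).

(* For B > 0, the map (r, s) |-> (0, B oval_lift s) + r (oval1 s, oval2 s) is
   2pi-periodic in s and winds around a segment of the second axis.  Since
   oval_lift' = oval1 and (oval1, oval2)' = kap / oval_h^2 tau, its partial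
   derivatives are nu and B oval1 oval2 nu + (B oval1^2 + r kap / oval_h^2) tau
   in the orthonormal frame nu = (oval1, oval2), tau = (- oval2, oval1); the last
   coefficient is at least B as soon as r >= B kap.  Letting r grow linearly with
   s turns this into a spiral. *)
Let q : K := Num.sqrt (1 - kap ^+ 2).
Definition oval_h (s : K) := Num.sqrt (cos s ^+ 2 + kap ^+ 2 * sin s ^+ 2).
Definition oval1 (s : K) := cos s / oval_h s.
Definition oval2 (s : K) := kap * (sin s / oval_h s).
Definition oval_lift (s : K) := q^-1 * atan (q * (sin s / oval_h s)).

Let h2_gt0 s : 0 < cos s ^+ 2 + kap ^+ 2 * sin s ^+ 2.
Proof.
have := cos2Dsin2 s; have := sqr_ge0 (cos s); have := sqr_ge0 (sin s).
have : 0 < kap ^+ 2 by rewrite exprn_gt0.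
by nra.
Qed.

Lemma oval_h_gt0 s : 0 < oval_h s. Proof. by rewrite sqrtr_gt0. Qed.

Lemma oval_h2 s : oval_h s ^+ 2 = cos s ^+ 2 + kap ^+ 2 * sin s ^+ 2.
Proof. by rewrite sqr_sqrtr// ltW. Qed.

Let q2 : q ^+ 2 = 1 - kap ^+ 2.
Proof. by rewrite sqr_sqrtr// subr_ge0 exprn_ile1// ltW. Qed.

Let q_gt0 : 0 < q. Proof. by rewrite sqrtr_gt0 subr_gt0 exprn_ilt1// ltW. Qed.

Lemma oval_norm s : oval1 s ^+ 2 + oval2 s ^+ 2 = 1.
Proof.
have h0 := lt0r_neq0 (oval_h_gt0 s).
transitivity ((cos s ^+ 2 + kap ^+ 2 * sin s ^+ 2) / oval_h s ^+ 2).
  by rewrite /oval1 /oval2; field.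
by rewrite -oval_h2 divff// expf_neq0.
Qed.

Lemma is_derive_oval_h (s : K) :
  is_derive s 1 oval_h (- ((1 - kap ^+ 2) * (sin s * cos s)) / oval_h s).
Proof.
have h := @is_derive1_sqrt K _ (h2_gt0 s).
have hg : is_derive s 1 (fun t => cos t ^+ 2 + kap ^+ 2 * sin t ^+ 2)
   (2 * cos s * (- sin s) + kap ^+ 2 * (2 * sin s * cos s)).
  apply: is_derive_eq; rewrite /GRing.scale /=. ring.
have hc : is_derive s 1 oval_h _ := 
  (@is_derive1_comp _ Num.sqrt (fun t => cos t ^+ 2 + kap ^+ 2 * sin t ^+ 2) s _ _ h hg).
apply: (is_derive_eq hc).
rewrite /GRing.scale /= -/(oval_h s); field; exact/lt0r_neq0/oval_h_gt0.
Qed.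

Lemma is_derive_oval1 (s : K) :
  is_derive s 1 oval1 (- (kap / oval_h s ^+ 2 * oval2 s)).
Proof.
have h0 := lt0r_neq0 (oval_h_gt0 s); have hh := is_derive_oval_h s.
have hV := is_deriveV h0 hh.
have hc : is_derive s 1 oval1 _ := (is_deriveM (is_derive_cos s) hV).
apply: (is_derive_eq hc).
rewrite /GRing.scale /= /oval2.
have := oval_h2 s; move: h0; set k := oval_h s => k0 k2.
have c2 : cos s ^+ 2 = 1 - sin s ^+ 2 by rewrite -(cos2Dsin2 s) addrK.
have e : k ^+ 2 = 1 - (1 - kap ^+ 2) * sin s ^+ 2 by rewrite k2 c2; ring.
transitivity (sin s / k ^+ 3 * ((1 - kap ^+ 2) * cos s ^+ 2 - k ^+ 2)); first by field.
have -> : (1 - kap ^+ 2) * cos s ^+ 2 - k ^+ 2 = - kap ^+ 2 by rewrite e c2; ring.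
by field.
Qed.

Lemma is_derive_sin_oval_h (s : K) : is_derive s 1 (fun s => sin s / oval_h s)
  (cos s / oval_h s ^+ 3).
Proof.
have h0 := lt0r_neq0 (oval_h_gt0 s); have hh := is_derive_oval_h s.
have hV := is_deriveV h0 hh.
have hc : is_derive s 1 (fun s => sin s / oval_h s) _ := (is_deriveM (is_derive_sin s) hV).
apply: (is_derive_eq hc).
rewrite /GRing.scale /=.
have := oval_h2 s; move: h0; set k := oval_h s => k0 k2.
have c2 : cos s ^+ 2 = 1 - sin s ^+ 2 by rewrite -(cos2Dsin2 s) addrK.
have e : k ^+ 2 = 1 - (1 - kap ^+ 2) * sin s ^+ 2 by rewrite k2 c2; ring.
transitivity (cos s / k ^+ 3 * ((1 - kap ^+ 2) * sin s ^+ 2 + k ^+ 2)); first by field.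
have -> : (1 - kap ^+ 2) * sin s ^+ 2 + k ^+ 2 = 1 by rewrite e; ring.
by field.
Qed.

Lemma is_derive_oval2 (s : K) : is_derive s 1 oval2 (kap / oval_h s ^+ 2 * oval1 s).
Proof.
have h0 := lt0r_neq0 (oval_h_gt0 s).
have hs := is_derive_sin_oval_h s.
have hc : is_derive s 1 oval2 _ := (is_deriveZ kap hs).
apply: (is_derive_eq hc).
by rewrite /GRing.scale /= /oval1; field.
Qed.

Lemma is_derive_oval_lift (s : K) : is_derive s 1 oval_lift (oval1 s).
Proof.
have h0 := lt0r_neq0 (oval_h_gt0 s); have q0 := lt0r_neq0 q_gt0.
have hs := is_deriveZ q (is_derive_sin_oval_h s).
have ha := @is_derive1_comp _ atan (fun s => q * (sin s / oval_h s)) s _ _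
  (is_derive1_atan _) hs.
have hc : is_derive s 1 oval_lift _ := (is_deriveZ q^-1 ha).
apply: (is_derive_eq hc).
rewrite /GRing.scale /= /oval1.
have := oval_h2 s; move: h0; set k := oval_h s => k0 k2.
have e : q ^+ 2 * sin s ^+ 2 + k ^+ 2 = 1.
  have c2 : cos s ^+ 2 = 1 - sin s ^+ 2 by rewrite -(cos2Dsin2 s) addrK.
  by rewrite q2 k2 c2; ring.
have -> : 1 + (q * (sin s / k)) ^+ 2 = (k ^+ 2)^-1.
  have -> : 1 + (q * (sin s / k)) ^+ 2 = (q ^+ 2 * sin s ^+ 2 + k ^+ 2) / k ^+ 2.
    by field.
  by rewrite e mul1r.
by field; rewrite k0.
Qed.

Section Cr_oval.
Context (V : normedModType K) (U : set V) (openU : open U).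

Lemma Cr_oval_h r (f : V -> K) : Cr r U f -> Cr r U (fun x => oval_h (f x)).
Proof.
move=> /(Cr_sin_cos openU)[hs hc].
apply: (@Cr_sqrt _ _ _ openU _
  (fun x => cos (f x) ^+ 2 + kap ^+ 2 * sin (f x) ^+ 2)) => //.
apply: CrD => //; first exact: (CrM openU hc hc).
by apply: CrM => //; [exact: Cr_cst|exact: (CrM openU hs hs)].
Qed.

Let Cr_oval_hV r (f : V -> K) : Cr r U f -> Cr r U (fun x => (oval_h (f x))^-1).
Proof.
move=> hf; apply: CrV => // [x _|]; last exact: Cr_oval_h.
exact/lt0r_neq0/oval_h_gt0.
Qed.

Lemma Cr_oval1 r (f : V -> K) : Cr r U f -> Cr r U (fun x => oval1 (f x)).
Proof.
move=> hf; have [hs hc] := Cr_sin_cos openU hf.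
by apply: CrM => //; exact: Cr_oval_hV.
Qed.

Let Cr_sin_oval_h r (f : V -> K) :
  Cr r U f -> Cr r U (fun x => sin (f x) / oval_h (f x)).
Proof.
move=> hf; have [hs hc] := Cr_sin_cos openU hf.
by apply: CrM => //; exact: Cr_oval_hV.
Qed.

Lemma Cr_oval2 r (f : V -> K) : Cr r U f -> Cr r U (fun x => oval2 (f x)).
Proof.
by move=> hf; apply: CrM => //; [exact: Cr_cst|exact: Cr_sin_oval_h].
Qed.

Lemma Cr_oval_lift r (f : V -> K) : Cr r U f -> Cr r U (fun x => oval_lift (f x)).
Proof.
move=> hf; apply: CrM => //; first exact: Cr_cst.
apply: Cr_atan => //; apply: CrM => //; [exact: Cr_cst|exact: Cr_sin_oval_h].
Qed.

End Cr_oval.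

(** Both functions increase with [sin s / oval_h s]. This monotonicity is what makes the spiral
    injective, by way of [polar_inj]. *)
Lemma oval_lift_lt s t : oval2 s < oval2 t -> oval_lift s < oval_lift t.
Proof.
rewrite /oval2 /oval_lift ltr_pM2l// => st.
by rewrite ltr_pM2l ?invr_gt0//; apply: lt_atan; rewrite ltr_pM2l.
Qed.

Lemma oval_lift_eq s t : oval2 s = oval2 t -> oval_lift s = oval_lift t.
Proof. by rewrite /oval2 /oval_lift => /(mulfI (lt0r_neq0 kap0)) ->. Qed.

(** The bound on [kap] gives [q >= 1/2], and the arctangent is at most 2 in absolute value. *)
Lemma normr_oval_lift s : kap <= 1 / 2 -> `|oval_lift s| <= 4.
Proof.
move=> kap2; have qh : 1 / 2 <= q.
  have q0 := q_gt0; have k0 := kap0.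
  rewrite -(@ler_pXn2r _ 2) ?nnegrE; [|by []|lra|lra].
  have : kap ^+ 2 <= (1 / 2) ^+ 2 by apply: lerXn2r => //; rewrite nnegrE; lra.
  by rewrite q2 !expr2; lra.
have a2 x : `|@atan K x| <= 2.
  have := atan_ltpi2 x; have := atan_gtNpi2 x; have := @pihalf_lt2 K.
  by rewrite ler_norml => ? ? ?; apply/andP; split; lra.
have qi : q^-1 <= 2.
  by rewrite -[leRHS]invrK lef_pV2 ?posrE//; lra.
rewrite normrM (ger0_norm (ltW _)) ?invr_gt0//.
apply: le_trans (ler_pM _ _ qi (a2 _)) _ => //; last lra.
by rewrite invr_ge0 ltW.
Qed.

(** The sum of the squares of [cos s / oval_h s] and [sin s / oval_h s] is [1 / oval_h s ^+ 2], so
    the two quotients determine [oval_h s], and then the cosine and sine. *)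
Lemma oval_eq s t : oval1 s = oval1 t -> oval2 s = oval2 t ->
  cos s = cos t /\ sin s = sin t.
Proof.
move=> e1 /(mulfI (lt0r_neq0 kap0)) e2.
have s0 := oval_h_gt0 s; have t0 := oval_h_gt0 t.
have hst : oval_h s = oval_h t.
  have e : oval_h s ^-2 = oval_h t ^-2.
    transitivity (oval1 s ^+ 2 + (sin s / oval_h s) ^+ 2).
      rewrite /oval1 !exprMn -mulrDl cos2Dsin2 mul1r exprVn//.
    by rewrite e1 e2 /oval1 !exprMn -mulrDl cos2Dsin2 mul1r exprVn.
  by move/invr_inj/eqP: e; rewrite eqrXn2 ?ltW// => /eqP.
have V0 : (oval_h t)^-1 != 0 by rewrite invr_neq0// gt_eqF.
by split; [move: e1|move: e2]; rewrite /oval1 hst; exact: mulIf.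
Qed.

Lemma cos_eq1_small (x : K) : `|x| <= pi -> cos x = 1 -> x = 0.
Proof.
move=> xpi cx; apply/eqP; rewrite -normr_eq0; apply/eqP.
apply: (@cos_inj K).
- by rewrite in_itv /= normr_ge0.
- by rewrite in_itv /= lexx pi_ge0.
- rewrite cos0 -cx; case: (ler0P x) => // _; by rewrite cosN.
Qed.

End oval.

(** * Linear algebra and plane geometry of the fold *)

Section fold_algebra.
Context (K : realType).

(** Testing on the identity matrix shows that the squared determinant is at least 1. *)
Lemma expanding_unitmx n (M : 'M[K]_n) : expanding_mx n M -> M \in unitmx.
Proof.
move=> /(_ 1%:M); rewrite !mul1mx trmx1 det1 det_mulmx det_tr unitmxE unitfE.
by case: eqP => // ->; rewrite mul0r ler10.
Qed.

(** For the 2 by 2 block [N] with rows [(a1, a2)] and [(b1, b2)], the inequalities say that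
    [N N^T - 1] has positive first entry and nonnegative determinant. It is then positive
    semidefinite, and [expanding_gram] applies to its square root. *)
Lemma expanding_two_coords k n (i j : 'I_n) (a1 a2 b1 b2 : K) (M : 'M[K]_n) :
  i != j -> 1 < a1 ^+ 2 + a2 ^+ 2 ->
  (a1 * b1 + a2 * b2) ^+ 2 <=
    (a1 ^+ 2 + a2 ^+ 2 - 1) * (b1 ^+ 2 + b2 ^+ 2 - 1) ->
  (forall a, M a i = (a == i)%:R * a1 + (a == j)%:R * b1) ->
  (forall a, M a j = (a == i)%:R * a2 + (a == j)%:R * b2) ->
  (forall a l, l != i -> l != j -> M a l = (a == l)%:R) ->
  expanding_mx k M.
Proof.
move=> ij A0 hD Mi Mj Ml.
set A := a1 ^+ 2 + a2 ^+ 2 - 1 in hD; set D := b1 ^+ 2 + b2 ^+ 2 - 1 in hD.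
set C := a1 * b1 + a2 * b2 in hD.
have {}A0 : 0 < A by rewrite subr_gt0.
pose sA := Num.sqrt A; pose sD := Num.sqrt (D - C ^+ 2 / A).
have sA2 : sA ^+ 2 = A by rewrite sqr_sqrtr// ltW.
have sA0 : sA != 0 by rewrite gt_eqF// sqrtr_gt0.
have sD2 : sD ^+ 2 = D - C ^+ 2 / A.
  by rewrite sqr_sqrtr// subr_ge0 ler_pdivrMr// mulrC.
(* the lower triangular square root of the nontrivial block of [M M^T - 1] *)
pose B : 'M[K]_(n, 2) := \matrix_(a, l)
  if l == 0 then (a == i)%:R * sA + (a == j)%:R * (C / sA) else (a == j)%:R * sD.
apply: (@expanding_gram _ _ _ _ _ B); apply/matrixP => a b.
rewrite !mxE (bigD1 i)//= (bigD1 j)/=; last by rewrite eq_sym.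
rewrite !mxE !Mi !Mj big_ord_recl big_ord_recl big_ord0 !mxE /=.
have -> : \sum_(l < n | (l != i) && (l != j)) M a l * M^T l b =
    (a == b)%:R * (a != i)%:R * (a != j)%:R.
  transitivity (\sum_(l < n | (l != i) && (l != j)) ((a == l)%:R * (b == l)%:R : K)).
    by apply: eq_bigr => l /andP[li lj]; rewrite !mxE !Ml.
  have [/andP[ai aj]|aij] := boolP ((a != i) && (a != j)).
    rewrite (bigD1 a)/= ?ai// eqxx mul1r big1 ?addr0.
      by rewrite aj !mulr1 eq_sym.
    by move=> l /andP[_ la]; rewrite eq_sym (negbTE la) mul0r.
  rewrite big1 => [|l /andP[li lj]].
    by rewrite -mulrA -natrM mulnb (negbTE aij) mulr0.
  have -> : (a == l) = false; last by rewrite mul0r.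
  by apply: contraNF aij => /eqP ->; rewrite li lj.
have hCA : (C / sA) ^+ 2 + sD ^+ 2 = D.
  by rewrite expr_div_n sA2 sD2 addrC subrK.
have hC : sA * (C / sA) = C by rewrite mulrC divfK.
have hA : sA * sA = A by rewrite -expr2.
have hCA' : C / sA * (C / sA) + sD * sD = D by rewrite -!expr2.
have ji : (j == i) = false by rewrite eq_sym (negbTE ij).
have hD' : b1 * b1 + b2 * b2 = 1 + D by rewrite /D !expr2; ring.
have hA' : a1 * a1 + a2 * a2 = 1 + A by rewrite /A !expr2; ring.
move: B Mi Mj Ml => _ _ _ _.
case: (eqVneq a i) => [?|ai]; [|case: (eqVneq a j) => [?|aj]];
  (case: (eqVneq b i) => [?|bi]; [|case: (eqVneq b j) => [?|bj]]);
  subst; rewrite ?eqxx ?(negbTE ij) ?ji 1?[_ == b]eq_sym 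
    ?(mul0r, mul1r, mulr0, mulr1, add0r, addr0) //=.
- by rewrite hA' hA.
- by rewrite (negbTE bi).
- by rewrite mulrC [b2 * _]mulrC [RHS]mulrC hC.
- by rewrite hCA' hD'.
- by rewrite (negbTE bj).
Qed.

(** On a vertical line, a point whose direction from the origin is steeper lies higher. In the upper
    half plane the contrary would force [r' < r] and a strictly smaller abscissa for the steeper
    point. *)
Lemma polar_not_lt (r r' x1 x2 y1 y2 : K) : 0 < r -> 0 < r' ->
  x1 ^+ 2 + x2 ^+ 2 = 1 -> y1 ^+ 2 + y2 ^+ 2 = 1 ->
  r * x1 = r' * y1 -> x2 < y2 -> r' * y2 < r * x2 -> False.
Proof.
move=> r0 r'0 xx yy e1 xy yx.
(* The central symmetry exchanges the roles of the two points; if the heights have opposite signs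
   the hypotheses contradict each other. *)
wlog x20 : r r' x1 x2 y1 y2 r0 r'0 xx yy e1 xy yx / 0 <= x2.
  have [|x20] := leP 0 x2; first by move=> + h; exact: (h r r' x1 x2 y1 y2).
  have [y20|y20] := leP y2 0.
    move=> /(_ r' r (- y1) (- y2) (- x1) (- x2)); apply => //.
    by rewrite sqrrN [(- y2) ^+ 2]sqrrN.
    by rewrite sqrrN [(- x2) ^+ 2]sqrrN.
    by rewrite !mulrN e1.
    by rewrite ltrN2.
    by rewrite !mulrN ltrN2.
    by rewrite oppr_ge0.
  have : r * x2 < 0 by rewrite pmulr_rlt0.
  have : 0 < r' * y2 by rewrite mulr_gt0.
  lra.
have y20 : 0 < y2 by exact: le_lt_trans xy.
have rr : r' < r.
  rewrite ltNge; apply/negP => rr.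
  have : r * x2 <= r' * y2 by apply: ler_pM => //; exact: ltW.
  by rewrite leNgt yx.
have e2 : r ^+ 2 * x1 ^+ 2 = r' ^+ 2 * y1 ^+ 2 by rewrite -!exprMn e1.
have r2 : r' ^+ 2 < r ^+ 2 by rewrite ltr_pXn2r// nnegrE ltW.
have x2y2 : x2 ^+ 2 < y2 ^+ 2 by rewrite ltr_pXn2r// nnegrE ltW.
have xy1 : y1 ^+ 2 < x1 ^+ 2 by lra.
have : r' ^+ 2 * y1 ^+ 2 < r ^+ 2 * x1 ^+ 2.
  by apply: ltr_pM => //; exact: sqr_ge0.
by rewrite e2 ltxx.
Qed.

(** Here [c] and [d] are the heights of two centres, ordered like the vertical components of the
    directions. If these components differed, [polar_not_lt] would be violated; if they agree, the
    centres coincide. *)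
Lemma polar_inj (r r' x1 x2 y1 y2 c d : K) : 0 < r -> 0 < r' ->
  x1 ^+ 2 + x2 ^+ 2 = 1 -> y1 ^+ 2 + y2 ^+ 2 = 1 ->
  (x2 < y2 -> c < d) -> (y2 < x2 -> d < c) -> (x2 = y2 -> c = d) ->
  r * x1 = r' * y1 -> c + r * x2 = d + r' * y2 ->
  [/\ r = r', x1 = y1 & x2 = y2].
Proof.
move=> r0 r'0 xx yy h1 h2 h3 e1 e2.
have [xy|yx|xy] := ltgtP x2 y2.
- exfalso; apply: (polar_not_lt r0 r'0 xx yy e1 xy).
  by have := h1 xy; lra.
- exfalso; apply: (polar_not_lt r'0 r0 yy xx (esym e1) yx).
  by have := h2 yx; lra.
have cd := h3 xy.
have e3 : r * x2 = r' * x2 by rewrite [in RHS]xy; lra.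
(* For horizontal directions the second coordinate says nothing about the radii; they are compared
   through the squared abscissas. *)
have [x20|x20] := eqVneq x2 0; last first.
  have rr : r = r' by exact: (mulIf x20 e3).
  by split => //; move: e1; rewrite rr; apply: mulfI; rewrite gt_eqF.
have x12 : x1 ^+ 2 = 1 by move: xx; rewrite x20; lra.
have y12 : y1 ^+ 2 = 1 by move: yy; rewrite -xy x20; lra.
have rr : r = r'.
  have : r ^+ 2 = r' ^+ 2.
    have : (r * x1) ^+ 2 = (r' * y1) ^+ 2 by rewrite e1.
    by rewrite !exprMn x12 y12 !mulr1.
  by move/eqP; rewrite eqrXn2 ?ltW// => /eqP.
by split => //; move: e1; rewrite rr; apply: mulfI; rewrite gt_eqF.
Qed.

End fold_algebra.

(** * The spiral map *)

Section fold.
Context (K : realType).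

Lemma Cr_proj n r (U : set 'rV[K]_n) i :
  open U -> Cr r U (fun x : 'rV[K]_n => x 0 i).
Proof.
move=> openU; apply: (Cr_coord (f := id)) => //.
by apply: (@Cr_linear _ _ _ openU _ r idfun) => x; exact: cvg_id.
Qed.

Lemma is_derive_proj n (i : 'I_n) (x v : 'rV[K]_n) :
  is_derive x v (fun y : 'rV[K]_n => y 0 i) (v 0 i).
Proof.
have [d1 _] := @Cr_proj n 1 setT i openT.
apply: DeriveDef; first exact/diff_derivable/d1.
have := derive_mx (@derivable_id _ _ x v).
by rewrite derive_id => /(congr1 (fun M : 'rV[K]_n => M 0 i)); rewrite mxE.
Qed.

Lemma normr_le1_circle (x y : K) : x ^+ 2 + y ^+ 2 = 1 -> `|x| <= 1.
Proof.
move=> xy; rewrite -(@ler_pXn2r _ 2) ?nnegrE// expr1n real_normK ?num_real//.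
by rewrite -xy lerDl sqr_ge0.
Qed.

(** Coordinate [j] becomes the angle and coordinate [i] the thickness of a spiral in the
    [(i, j)]-plane. The constants leave room for the stretching factor 2 and for all the turns. *)
Lemma fold_embeds k n (i j : 'I_n) (S R : 'I_n -> K) : i != j ->
  (forall l, 0 < S l) -> (forall l, l != i -> l != j -> S l <= R l) ->
  R i <= R j -> 32 * S i <= R i -> 1024 * (S i * S j) <= R i * R j ->
  embeds k S R.
Proof.
move=> ij S0 SR Rij SRi SRij.
have Si0 := S0 i; have Sj0 := S0 j.
have Ri0 : 0 < R i by lra.
have Rj0 : 0 < R j by lra.
(* The lift is at most 4 in absolute value, so [2 * B] times it stays within [R j / 4]. The
   innermost radius [kap * B] is [R i / 64], and [R i <= R j] gives [kap <= 1 / 2]. *)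
pose B := R j / 32; pose kap := R i / (2 * R j); pose w := S i.
have B0 : 0 < B by rewrite divr_gt0.
have kap0 : 0 < kap by rewrite divr_gt0// mulr_gt0.
have kaph : kap <= 1 / 2 by rewrite ler_pdivrMr ?mulr_gt0//; lra.
have kap1 : kap < 1 by lra.
have pi0 : 0 < pi :> K := @pi_gt0 K.
have pi2 : 2 <= pi :> K := @pi_ge2 K.
pose s (x : 'rV[K]_n) : K := x 0 j * B^-1.
(* The term [kap * B] meets the lower bound on the radius required for expansion. The last term adds
   [2 * w] per turn, more than the thickness [w] of a layer, so successive turns stay apart. *)
pose r (x : 'rV[K]_n) : K := kap * B + x 0 i + w / pi * s x.
(* The factor 2 compensates for the shear [e] below: without it the differential could shorten some
   vectors. *)
pose X (x : 'rV[K]_n) : K := R i / 2 + 2 * (r x * oval1 kap (s x)).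
pose Y (x : 'rV[K]_n) : K :=
  R j / 2 + 2 * (B * oval_lift kap (s x) + r x * oval2 kap (s x)).
pose I (x : 'rV[K]_n) : 'rV[K]_n :=
  \row_l if l == i then X x else if l == j then Y x else x 0 l.
have ji : (j == i) = false by rewrite eq_sym (negbTE ij).
have Ii (x : 'rV[K]_n) : I x 0 i = X x by rewrite mxE eqxx.
have Ij (x : 'rV[K]_n) : I x 0 j = Y x by rewrite mxE ji eqxx.
have Il (x : 'rV[K]_n) l : l != i -> l != j -> I x 0 l = x 0 l.
  by rewrite mxE => /negbTE-> /negbTE->.
have Crs m : Cr m setT s.
  by apply: CrM; [exact: openT|apply: Cr_proj; exact: openT|exact/Cr_cst/openT].
have Crr m : Cr m setT r.
  apply: CrD; [exact: openT| |]; last first.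
    by apply: CrM; [exact: openT|exact/Cr_cst/openT|exact: Crs].
  by apply: CrD; [exact: openT|exact/Cr_cst/openT|apply: Cr_proj; exact: openT].
have CrX m : Cr m setT X.
  apply: CrD; [exact: openT|exact/Cr_cst/openT|].
  apply: CrM; [exact: openT|exact/Cr_cst/openT|].
  by apply: CrM; [exact: openT|exact: Crr|apply: Cr_oval1 => //; exact: openT].
have CrY m : Cr m setT Y.
  apply: CrD; [exact: openT|exact/Cr_cst/openT|].
  apply: CrM; [exact: openT|exact/Cr_cst/openT|].
  apply: CrD; [exact: openT| |].
    apply: CrM; [exact: openT|exact/Cr_cst/openT|].
    by apply: Cr_oval_lift => //; exact: openT.
  by apply: CrM; [exact: openT|exact: Crr|apply: Cr_oval2 => //; exact: openT].
have CrI m : Cr m setT I.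
  apply: Cr_mx => [|l]; first exact: openT.
  have [->|li] := eqVneq l i.
    by apply: Cr_ext (CrX m) => [|x _]; [exact: openT|rewrite Ii].
  have [->|lj] := eqVneq l j.
    by apply: Cr_ext (CrY m) => [|x _]; [exact: openT|rewrite Ij].
  have h := @Cr_proj n m setT l openT.
  by apply: Cr_ext h => [|x _]; [exact: openT|rewrite Il].
have dI (x : 'rV[K]_n) : differentiable I x by have [h _] := CrI 1%N; exact: h.
have ds (x : 'rV[K]_n) : differentiable s x by have [h _] := Crs 1%N; exact: h.
have Ds (x v : 'rV[K]_n) : is_derive x v s (v 0 j / B).
  have hp := is_derive_proj j x v.
  have hc : is_derive x v s _ := is_deriveM hp (is_derive_cst B^-1 x v).
  by apply: (is_derive_eq hc); rewrite /GRing.scale /= mulr0 add0r mulrC.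
have Dr (x v : 'rV[K]_n) : is_derive x v r (v 0 i + w / pi * (v 0 j / B)).
  have hp := is_derive_proj i x v.
  have hc : is_derive x v r _ :=
    is_deriveD (is_deriveD (is_derive_cst (kap * B) x v) hp)
     (is_deriveZ (w / pi) (Ds x v)).
  by apply: (is_derive_eq hc); rewrite add0r.
have Dphi (x v : 'rV[K]_n) (phi : K -> K) (p : K) : is_derive (s x) 1 phi p ->
    is_derive x v (phi \o s) (p * (v 0 j / B)).
  by apply: is_derive_comp1 => //; have [_ ->] := Ds x v.
have JE (x : 'rV[K]_n) a l : 'J I x a l = 'D_(delta_mx 0 a) (fun y => I y 0 l) x.
  transitivity (((delta_mx 0 a : 'rV[K]_n) *m 'J I x) 0 l); first by rewrite -rowE [RHS]mxE.
  rewrite -(deriveEjacobian _ (dI x)) derive_mx; last exact: diff_derivable.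
  by rewrite mxE.
(* the rows of the differential in the frame (nu, tau) are (2, 0) and (2 e, 2 g) *)
pose e (x : 'rV[K]_n) : K := w / pi / B + oval1 kap (s x) * oval2 kap (s x).
pose g (x : 'rV[K]_n) : K := oval1 kap (s x) ^+ 2 + r x / B * (kap / oval_h kap (s x) ^+ 2).
have DX (x v : 'rV[K]_n) : 'D_v X x = v 0 i * (2 * oval1 kap (s x)) +
    v 0 j * (2 * (e x * oval1 kap (s x) - g x * oval2 kap (s x))).
  have h1 := Dphi x v _ _ (is_derive_oval1 kap0 (s x)).
  have hc : is_derive x v X _ := is_deriveD (is_derive_cst (R i / 2) x v)
     (is_deriveZ 2 (is_deriveM (Dr x v) h1)).
  have [_ ->] := hc; rewrite /GRing.scale /= add0r /e /g.
  have := oval_norm kap0 (s x); move: (oval1 _ _) (oval2 _ _) (oval_h _ _ ^+ 2).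
  by move=> n1 n2 h2 nn; ring.
have DY (x v : 'rV[K]_n) : 'D_v Y x = v 0 i * (2 * oval2 kap (s x)) +
    v 0 j * (2 * (e x * oval2 kap (s x) + g x * oval1 kap (s x))).
  have h1 := Dphi x v _ _ (is_derive_oval2 kap0 (s x)).
  have h2 := Dphi x v _ _ (is_derive_oval_lift kap0 kap1 (s x)).
  have hc : is_derive x v Y _ := is_deriveD (is_derive_cst (R j / 2) x v)
     (is_deriveZ 2 (is_deriveD (is_deriveZ B h2) (is_deriveM (Dr x v) h1))).
  have [_ ->] := hc; rewrite /GRing.scale /= add0r /e /g.
  have := oval_norm kap0 (s x); move: (oval1 _ _) (oval2 _ _) (oval_h _ _ ^+ 2).
  move=> n1 n2 k2 nn.
  have -> : B * (n1 * (v 0 j / B)) = (n1 ^+ 2 + n2 ^+ 2) * n1 * v 0 j.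
    by rewrite nn; field; rewrite gt_eqF.
  by ring.
(* Both terms of [e] are at most 1/2 in absolute value, as [w <= B], [pi >= 2] and [(oval1, oval2)]
   is a unit vector. Since [r x >= kap * B], [g] is at least [oval1 ^+ 2 + oval2 ^+ 2]. *)
have eg (x : 'rV[K]_n) : 0 <= x 0 i -> 0 <= x 0 j -> e x ^+ 2 <= 1 /\ 1 <= g x.
  move=> xi xj.
  have nn := oval_norm kap0 (s x); have h0 := oval_h_gt0 kap0 (s x).
  have sx0 : 0 <= s x by rewrite mulr_ge0// invr_ge0 ltW.
  have /andP[wB0 wB1] : 0 <= w / pi / B <= 1 / 2.
    apply/andP; split; first by rewrite !divr_ge0// ltW.
    rewrite ler_pdivrMr// ler_pdivrMr//.
    have : 0 <= B * (pi - 2) by rewrite mulr_ge0 ?subr_ge0// ltW.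
    have : w <= B by rewrite /w /B; lra.
    by lra.
  have n12 : `|oval1 kap (s x) * oval2 kap (s x)| <= 1 / 2.
    rewrite ler_norml; have := sqr_ge0 (oval1 kap (s x) - oval2 kap (s x)).
    have := sqr_ge0 (oval1 kap (s x) + oval2 kap (s x)).
    by move: nn; rewrite !expr2 => ? ? ?; apply/andP; split; nra.
  have [n12l n12r] : - (1 / 2) <= oval1 kap (s x) * oval2 kap (s x) /\
      oval1 kap (s x) * oval2 kap (s x) <= 1 / 2.
    by move: n12; rewrite ler_norml => /andP.
  split.
    rewrite -subr_ge0 (_ : 1 - e x ^+ 2 = (1 - e x) * (1 + e x)); last by ring.
    by rewrite mulr_ge0// /e; lra.
  have hk : 0 <= kap / oval_h kap (s x) ^+ 2.
    by rewrite divr_ge0 ?ltW// exprn_gt0.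
  have rB : kap <= r x / B.
    rewrite ler_pdivlMr// /r.
    have : 0 <= w / pi * s x by rewrite !mulr_ge0// ?invr_ge0 ltW.
    by lra.
  have h1 := ler_wpM2r hk rB.
  have h2 : oval2 kap (s x) ^+ 2 <= kap * (kap / oval_h kap (s x) ^+ 2).
    have -> : oval2 kap (s x) ^+ 2 =
        kap * (kap / oval_h kap (s x) ^+ 2) * sin (s x) ^+ 2.
      by rewrite /oval2; field; rewrite gt_eqF.
    have s1 : sin (s x) ^+ 2 <= 1 by rewrite sin2cos2 gerBl sqr_ge0.
    by rewrite ler_piMr// mulr_ge0// ltW.
  by rewrite /g; lra.
have expI (x : 'rV[K]_n) : 0 <= x 0 i -> 0 <= x 0 j -> forall m, expanding_mx m ('J I x).
  move=> xi xj m; have [e1 g1] := eg x xi xj.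
  have nn := oval_norm kap0 (s x).
  set n1 := oval1 kap (s x) in nn; set n2 := oval2 kap (s x) in nn.
  apply: (@expanding_two_coords _ m _ i j (2 * n1) (2 * n2)
    (2 * (e x * n1 - g x * n2)) (2 * (e x * n2 + g x * n1))) => //.
  - have -> : (2 * n1) ^+ 2 + (2 * n2) ^+ 2 = 4 * (n1 ^+ 2 + n2 ^+ 2) by ring.
    by rewrite nn; lra.
  - have -> : (2 * n1) ^+ 2 + (2 * n2) ^+ 2 = 4 * (n1 ^+ 2 + n2 ^+ 2) by ring.
    have -> : 2 * n1 * (2 * (e x * n1 - g x * n2)) +
      2 * n2 * (2 * (e x * n2 + g x * n1)) = 4 * e x * (n1 ^+ 2 + n2 ^+ 2) by ring.
    have -> : (2 * (e x * n1 - g x * n2)) ^+ 2 + (2 * (e x * n2 + g x * n1)) ^+ 2 =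
      4 * (e x ^+ 2 + g x ^+ 2) * (n1 ^+ 2 + n2 ^+ 2) by ring.
    (* What remains is [16 e^2 <= 3 (4 e^2 + 4 g^2 - 1)], which follows from [e^2 <= 1 <= g^2]. *)
    rewrite nn !mulr1 exprMn.
    have : 1 <= g x ^+ 2 by rewrite exprn_ege1.
    lra.
  - move=> a; rewrite JE; have -> : (fun y => I y 0 i) = X by apply/funext.
    by rewrite DX !mxE /= ![_ == a]eq_sym.
  - move=> a; rewrite JE; have -> : (fun y => I y 0 j) = Y by apply/funext.
    by rewrite DY !mxE /= ![_ == a]eq_sym.
  - move=> a l li lj; rewrite JE.
    have -> : (fun y => I y 0 l) = (fun y => y 0 l) by apply/funext => y; rewrite Il.
    by have [_ ->] := is_derive_proj l x (delta_mx 0 a); rewrite mxE /= eq_sym.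
have Ipos (x : 'rV[K]_n) : 0 <= x 0 i -> 0 <= x 0 j -> 0 < r x.
  move=> xi xj; rewrite /r.
  have : 0 <= w / pi * s x by rewrite !mulr_ge0// ?invr_ge0 ltW.
  have : 0 < kap * B by rewrite mulr_gt0.
  lra.
exists I; split.
- apply: smooth_embedding_box.
  + by move=> m; rewrite Cr_onE.
  + move=> x Sx; apply/expanding_unitmx/expI.
      by have /andP[/ltW] := Sx i.
    by have /andP[/ltW] := Sx j.
  + move=> x y /set_mem Sx /set_mem Sy /rowP xy.
    have /andP[xi0 xi1] := Sx i; have /andP[xj0 xj1] := Sx j.
    have /andP[yi0 yi1] := Sy i; have /andP[yj0 yj1] := Sy j.
    have e1 : r x * oval1 kap (s x) = r y * oval1 kap (s y).
      by have := xy i; rewrite !Ii /X; lra.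
    have e2 : B * oval_lift kap (s x) + r x * oval2 kap (s x) =
        B * oval_lift kap (s y) + r y * oval2 kap (s y).
      by have := xy j; rewrite !Ij /Y; lra.
    have [|||rxy n1xy n2xy] := polar_inj (Ipos x xi0 xj0) (Ipos y yi0 yj0)
      (oval_norm kap0 (s x)) (oval_norm kap0 (s y)) _ _ _ e1 e2.
    * by move=> h; rewrite ltr_pM2l//; exact: oval_lift_lt.
    * by move=> h; rewrite ltr_pM2l//; exact: oval_lift_lt.
    * by move=> /(oval_lift_eq kap0) ->.
    have [cxy sxy] := oval_eq kap0 n1xy n2xy.
    (* Radius and direction agree, so the angles differ by a multiple of a full turn. Since [x 0 i]
       and [y 0 i] differ by at most [w], the angles differ by at most [pi], hence not at all. *)
    have rxy' : x 0 i - y 0 i = w / pi * (s y - s x).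
      by move: rxy; rewrite /r; lra.
    have sE : s y - s x = 0.
      apply: cos_eq1_small; last first.
        by rewrite cosB cxy sxy -!expr2 cos2Dsin2.
      have wpi : 0 < w / pi by rewrite divr_gt0.
      rewrite -(ler_pM2l wpi) -[in leLHS](gtr0_norm wpi) -normrM -rxy'.
      rewrite divfK ?gt_eqF// ler_norml; apply/andP; split; rewrite /w; lra.
    apply/rowP => l; have [->|li] := eqVneq l i.
      by apply/eqP; rewrite -subr_eq0 rxy' sE mulr0.
    have [->|lj] := eqVneq l j.
      have : s x = s y by lra.
      by apply: mulIf; rewrite invr_neq0// gt_eqF.
    by have := xy l; rewrite !Il.
- move=> _ [x Sx <-] l.
  have /andP[xi0 xi1] := Sx i; have /andP[xj0 xj1] := Sx j.
  have r0 := Ipos x (ltW xi0) (ltW xj0).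
  (* The three terms of the radius are bounded by [R i / 64], [R i / 32] and [R i / 64]; the last
     bound uses the hypothesis on the areas of the faces. *)
  have rR : r x <= R i / 16.
    have h1 : kap * B = R i / 64 by rewrite /kap /B; field; rewrite gt_eqF.
    have h2 : w / pi * s x <= R i / 64.
      rewrite /s mulrA ler_pdivrMr// mulrAC ler_pdivrMr//.
      have h3 : S i * x 0 j <= S i * S j by rewrite ler_pM2l// ltW.
      have h4 : 0 <= R i * R j * (pi - 2) by rewrite !mulr_ge0 ?subr_ge0// ltW.
      by rewrite /w /B; lra.
    by rewrite /r h1; lra.
  have nn := oval_norm kap0 (s x).
  have nn' : oval2 kap (s x) ^+ 2 + oval1 kap (s x) ^+ 2 = 1 by rewrite addrC.
  have n1 : `|r x * oval1 kap (s x)| <= R i / 16.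
    rewrite normrM (gtr0_norm r0) -[leRHS]mulr1.
    exact: ler_pM (ltW r0) (normr_ge0 _) rR (normr_le1_circle nn).
  have n2 : `|r x * oval2 kap (s x)| <= R i / 16.
    rewrite normrM (gtr0_norm r0) -[leRHS]mulr1.
    exact: ler_pM (ltW r0) (normr_ge0 _) rR (normr_le1_circle nn').
  have nl : `|B * oval_lift kap (s x)| <= R j / 8.
    rewrite normrM (gtr0_norm B0).
    have := normr_oval_lift kap0 kap1 (s x) kaph.
    by rewrite -(ler_pM2l B0) /B; lra.
  move: n1 n2 nl; rewrite !ler_norml => /andP[? ?] /andP[? ?] /andP[? ?].
  have [->|li] := eqVneq l i; first by rewrite Ii /X; apply/andP; split; lra.
  have [->|lj] := eqVneq l j; first by rewrite Ij /Y; apply/andP; split; lra.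
  rewrite Il//; have /andP[-> xl] := Sx l.
  exact: lt_le_trans xl (SR l li lj).
- move=> x Sx; apply: expI.
    by have /andP[/ltW] := Sx i.
  by have /andP[/ltW] := Sx j.
Qed.

End fold.

(** * Sequences of folds *)

Section folding.
Context (K : realType) (n : nat).

Definition prefix_prod (T : 'I_n -> K) (l : nat) : K :=
  \prod_(i < n | (i < l)%N) T i.

Lemma prefix_prod_gt0 T l : (forall i, 0 < T i) -> 0 < prefix_prod T l.
Proof. by move=> T0; apply: prodr_gt0 => i _. Qed.

Lemma prefix_prodM (S T : 'I_n -> K) l :
  prefix_prod (fun i => S i * T i) l = prefix_prod S l * prefix_prod T l.
Proof. exact: big_split. Qed.

Lemma prefix_prod_split (T : 'I_n -> K) (j l : nat) : (j <= l)%N ->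
  prefix_prod T l = prefix_prod T j * \prod_(i < n | (j <= i < l)%N) T i.
Proof.
move=> jl; rewrite /prefix_prod (bigID (fun i : 'I_n => (i < j)%N)) /=.
congr (_ * _); apply: eq_bigl => i.
  by apply: andb_idl => ij; exact: leq_trans jl.
by rewrite -leqNgt andbC.
Qed.

Lemma prefix_prodS (T : 'I_n -> K) (j : 'I_n) :
  prefix_prod T j.+1 = prefix_prod T j * T j.
Proof.
rewrite (@prefix_prod_split T j)//; congr (_ * _).
rewrite (big_pred1 j)// => i /=.
by rewrite ltnS -eqn_leq eq_sym.
Qed.

(** Otherwise [T] and [R] agree before [j], and the excess at [j] violates the bound on the prefix
    product through [j]. *)
Lemma ex_deficient_before (T R : 'I_n -> K) (j : 'I_n) :
  (forall i, 0 < T i) -> (forall i : 'I_n, (i < j)%N -> T i <= R i) ->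
  R j < T j -> prefix_prod T j.+1 <= prefix_prod R j.+1 ->
  exists2 i : 'I_n, (i < j)%N & T i < R i.
Proof.
move=> T0 TR RTj; apply: contraPP => h.
have e : prefix_prod T j = prefix_prod R j.
  apply: eq_bigr => i ij; apply/eqP; rewrite eq_le TR//= leNgt.
  by apply/negP => TRi; apply: h; exists i.
rewrite !prefix_prodS -e ler_pM2l; last exact: prefix_prod_gt0.
by rewrite leNgt RTj.
Qed.

(** Induction on the number of sides that miss their target: one fold makes at least one more side
    exact and enlarges all the sides by a factor 32. *)
Lemma fold_chain k m (T R : 'I_n -> K) :
  (#|[pred i | T i != R i]| <= m)%N -> (forall i, 0 < T i) ->
  rectangle_dims R ->
  (forall l, (l <= n)%N -> prefix_prod T l <= prefix_prod R l) ->
  embeds k T (fun i => 32 ^+ m * R i).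
Proof.
elim: m T R => [|m IH] T R cardTR T0 [R0 Rle] TR.
  apply: (@embeds_diag _ _ _ (fun=> 1)) => // [i|f _]; last by rewrite big1.
  rewrite expr0 !mul1r; move: cardTR; rewrite leqn0 => /eqP/card0_eq/(_ i).
  by rewrite !inE => /negbFE/eqP ->.
have [/existsP[j0 hj0]|] := boolP [exists j, R j < T j]; last first.
  rewrite negb_exists => /forallP h.
  apply: (@embeds_diag _ _ _ (fun=> 1)) => // [i|f _]; last by rewrite big1.
  rewrite mul1r (le_trans _ (_ : R i <= _))//; first by rewrite leNgt h.
  by apply: ler_peMl; [exact: ltW|rewrite exprn_ege1// ler1n].
(* The pair consists of the first side [j] in excess and the last deficient side [i] before it; the
   sides strictly between are then exact. *)
case: (@arg_minnP _ j0 (fun j : 'I_n => R j < T j) (@nat_of_ord n) hj0) => /= j hj minj {j0 hj0}.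
have TRlt (i : 'I_n) : (i < j)%N -> T i <= R i.
  by move=> ij; rewrite leNgt; apply/negP => /minj; rewrite leqNgt ij.
have [i0 i0j hi0] := ex_deficient_before T0 TRlt hj (TR _ (ltn_ord j)).
pose P (i : 'I_n) := (i < j)%N && (T i < R i).
have Pi0 : P i0 by rewrite /P i0j.
case: (@arg_maxnP _ i0 P (@nat_of_ord n) Pi0) => /= i /andP[ij hi] maxi {i0 i0j hi0 Pi0}.
have TReq (l : 'I_n) : (i < l)%N -> (l < j)%N -> T l = R l.
  move=> il lj; apply/eqP; rewrite eq_le TRlt//= leNgt; apply/negP => h.
  by have := maxi l; rewrite /P lj h /= leqNgt il => /(_ isT).
have ij' : i != j by rewrite -val_eqE /= neq_ltn ij.
have ji' : (j == i) = false by rewrite eq_sym (negbTE ij').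
(* This is the largest factor that pushes neither side past its target; one of the two reaches
   it. *)
pose del := Num.min (R i / T i) (T j / R j).
have del1 : 1 < del by rewrite lt_min !ltr_pdivlMr// !mul1r hi.
have del0 : 0 < del by exact: lt_trans del1.
pose T' l := if l == i then T i * del else if l == j then T j / del else T l.
have T'i : T' i = T i * del by rewrite /T' eqxx.
have T'j : T' j = T j / del by rewrite /T' ji' eqxx.
have T'l l : l != i -> l != j -> T' l = T l by rewrite /T' => /negbTE-> /negbTE->.
have T'0 l : 0 < T' l.
  by rewrite /T'; case: ifP => // _; [|case: ifP => // _]; rewrite ?divr_gt0 ?mulr_gt0.
have Ri : T' i <= R i.
  by rewrite T'i mulrC -ler_pdivlMr// ge_min lexx.
have Rj : R j <= T' j.
  by rewrite T'j ler_pdivlMr// mulrC -ler_pdivlMr// ge_min lexx orbT.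
have cij : T' i * T' j = T i * T j.
  by rewrite T'i T'j mulrACA mulrC divff ?gt_eqF// mul1r.
have h1 : embeds k T (fun l => 32 * T' l).
  apply: (@fold_embeds _ k n i j) => //.
  - by move=> l li lj; rewrite T'l//; apply: ler_peMl; [exact: ltW|rewrite ler1n].
  - by rewrite ler_pM2l// (le_trans Ri)// (le_trans _ Rj)// Rle// ltnW.
  - by rewrite ler_pM2l// T'i; apply: ler_peMr; exact: ltW.
  - by rewrite mulrACA cij -natrM.
apply: (embeds_trans h1).
have -> : (fun l => 32 ^+ m.+1 * R l) = (fun l => 32 ^+ m * (32 * R l)).
  by apply/funext => l; rewrite exprSr mulrA.
apply: IH.
- rewrite -ltnS; apply: leq_trans cardTR; apply: proper_card; apply/properP.
  have sub : [pred l | 32 * T' l != 32 * R l] \subset [pred l | T l != R l].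
    apply/fintype.subsetP => l; rewrite !inE; apply: contra_neq => TRl.
    congr (_ * _); rewrite T'l//; apply: contra_eq_neq TRl => ->.
      by rewrite lt_eqF.
    by rewrite gt_eqF.
  split => //.
  have [le|lt] := leP (R i / T i) (T j / R j).
    exists i; rewrite !inE; first by rewrite lt_eqF.
    by rewrite negbK T'i /del (min_idPl le) [T i * _]mulrC divfK// gt_eqF.
  exists j; rewrite !inE; first by rewrite gt_eqF.
  by rewrite negbK T'j /del (min_idPr (ltW lt)) invf_div [T j * _]mulrC divfK// gt_eqF.
- by move=> l; rewrite mulr_gt0.
- split => [l|l l' ll']; first by rewrite mulr_gt0.
  by rewrite ler_pM2l// Rle.
(* A prefix that stops before [i] is unchanged, and one containing both [i] and [j] keeps its
   product. In between, the bound at [i] is extended factor by factor. *)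
move=> l ln; rewrite !prefix_prodM ler_pM2l; last by apply: prefix_prod_gt0.
have [li|il] := leqP l i.
  rewrite (_ : prefix_prod T' l = prefix_prod T l) ?TR//.
  apply: eq_bigr => x xl; have xi := leq_trans xl li.
  by rewrite T'l// -val_eqE neq_ltn ?xi// (ltn_trans xi ij).
have [lj|jl] := leqP l j.
  rewrite (prefix_prod_split T' (ltnW il)) (prefix_prod_split R (ltnW il)).
  apply: ler_pM; [exact/ltW/prefix_prod_gt0|by apply: prodr_ge0 => ? _; exact: ltW| |].
    rewrite (_ : prefix_prod T' i = prefix_prod T i); first by rewrite TR// ltnW.
    apply: eq_bigr => x xi.
    by rewrite T'l// -val_eqE neq_ltn ?xi// (ltn_trans xi ij).
  apply: ler_prod => x /andP[ix xl]; rewrite ltW//=.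
  have [->//|xi] := eqVneq x i.
  have xj := leq_trans xl lj.
  rewrite T'l// ?TReq// -?val_eqE ?neq_ltn ?xj//.
  by rewrite ltn_neqAle ix andbT eq_sym val_eqE.
rewrite (_ : prefix_prod T' l = prefix_prod T l) ?TR//.
rewrite /prefix_prod (bigD1 i)//= [RHS](bigD1 i)//=.
rewrite (bigD1 j)/= ?jl ?ji'// [in RHS](bigD1 j)/= ?jl ?ji'//.
rewrite !mulrA cij; congr (_ * _); apply: eq_bigr => x /andP[/andP[_ xi] xj].
exact: T'l.
Qed.

(** At most [n] folds occur, so the target is first shrunk by [32 ^+ n]; a prefix of length at most
    [n] loses at most [32 ^+ (n * n)]. *)
Lemma embeds_of_prefix_prod k (T R : 'I_n -> K) : (forall i, 0 < T i) ->
  rectangle_dims R ->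
  (forall l, (0 < l <= n)%N ->
     32 ^+ (n * n) * prefix_prod T l <= prefix_prod R l) ->
  embeds k T R.
Proof.
move=> T0 [R0 Rle] TR; pose c : K := 32 ^+ n.
have c0 : 0 < c by rewrite exprn_gt0.
have -> : R = fun i => 32 ^+ n * (c^-1 * R i).
  by apply/funext => i; rewrite mulVKf// gt_eqF.
apply: fold_chain => //.
- by rewrite (leq_trans (max_card _))// card_ord.
- split => [i|i j ij]; first by rewrite mulr_gt0// invr_gt0.
  by rewrite ler_pM2l ?invr_gt0// Rle.
move=> l ln; have [->|l0] := posnP l.
  by rewrite /prefix_prod !big_pred0.
rewrite prefix_prodM /prefix_prod prodr_const -/(prefix_prod R l) exprVn.
rewrite mulrC ler_pdivlMr ?exprn_gt0// mulrC.
have := TR l; rewrite l0 ln => /(_ isT); apply: le_trans.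
rewrite ler_pM2r; last exact: prefix_prod_gt0.
rewrite exprM ler_weXn2l//; first by rewrite exprn_ege1// ler1n.
by rewrite (leq_trans (max_card _))// card_ord.
Qed.

End folding.

(** * The linear step *)

Section stretching.
Context (K : realType).

Lemma powR_exprn (y : K) (m : nat) (p : K) :
  (y `^ p) ^+ m = y `^ (p * m%:R).
Proof. by rewrite -powR_mulrn ?powR_ge0// powRrM. Qed.

(** The exponent equals [(l - k) / (k - j) + 1], and the extra factor completes the prefix product
    up to [l]. *)
Lemma dims_product_prefix_prod n (R : 'I_n -> K) (k j l : nat) :
  (forall i, 0 < R i) -> (j < k)%N -> (k <= l)%N ->
  dims_product R k j l =
  prefix_prod R j `^ ((l - k)%:R / (k - j)%:R) * prefix_prod R l.
Proof.
move=> R0 jk kl; rewrite /dims_product -/(prefix_prod R j).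
rewrite [in RHS](prefix_prod_split R (ltnW (leq_trans jk kl))) mulrA.
congr (_ * _); have P0 := prefix_prod_gt0 j R0.
have kj0 : (k - j)%:R != 0 :> K by rewrite pnatr_eq0 subn_eq0 -ltnNge.
have -> : (l - j)%:R / (k - j)%:R = (l - k)%:R / (k - j)%:R + 1 :> K.
  rewrite -[X in _ = _ + X](divff kj0) -mulrDl -natrD; congr (_%:R / _).
  by rewrite addnBA ?(ltnW jk)// subnK.
by rewrite powRD ?powRr1 ?ltW// gt_eqF// implybT.
Qed.

(** In logarithms, [lam] is the smallest slope of a line through [(k, 0)] lying below the points
    [j < k], up to [log A]. The hypothesis at an extremal [j] then gives the bound for [l >= k]. *)
Lemma ex_stretch n k (A : K) (R S : 'I_n -> K) : 1 <= A -> (0 < k <= n)%N ->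
  (forall i, 0 < R i) -> (forall i, 0 < S i) ->
  (forall j l : nat, (j < k)%N -> (k <= l <= n)%N ->
     A ^+ n.+1 * dims_product S k j l <= dims_product R k j l) ->
  exists2 lam : K, 1 <= lam & forall l, (0 < l <= n)%N ->
    A * (lam ^+ l * prefix_prod S l) <= lam ^+ k * prefix_prod R l.
Proof.
move=> A1 /andP[k0 kn] R0 S0 hyp; have A0 : 0 < A by exact: lt_le_trans A1.
pose y (j : nat) := A * prefix_prod S j / prefix_prod R j.
have y0 j : 0 < y j by rewrite divr_gt0 ?mulr_gt0// prefix_prod_gt0.
have [lam [j [jk lam0 lamE ylam]]] : exists lam : K, exists j : nat,
    [/\ (j < k)%N, 0 < lam, lam = y j `^ (k - j)%:R^-1 &
        forall i, (i < k)%N -> y i <= lam ^+ (k - i)].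
  pose x (j : 'I_k) : K := y j `^ (k - j)%:R^-1.
  have [/= j _ xmax] := arg_maxP x (isT : xpredT (Ordinal k0)).
  exists (x j), j; split => [||//|i ik]; [exact: ltn_ord|exact: powR_gt0|].
  have -> : y i = x (Ordinal ik) ^+ (k - i).
    rewrite powR_exprn mulVf ?powRr1 ?ltW//.
    by rewrite pnatr_eq0 subn_eq0 -ltnNge.
  by apply: lerXn2r; rewrite ?nnegrE ?powR_ge0//; exact: xmax.
(* The index 0 gives [y 0 = A], so [lam ^+ k >= A >= 1]. *)
have lam1 : 1 <= lam.
  rewrite leNgt; apply/negP => h.
  have := ylam 0 k0; rewrite subn0 /y /prefix_prod !big_pred0//.
  rewrite mulr1 divr1 leNgt (lt_le_trans _ A1)// exprn_ilt1 ?ltW//.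
  by rewrite -lt0n.
exists lam => // l /andP[l0 ln].
have P0 := prefix_prod_gt0 l R0.
have [lk|kl] := ltnP l k.
  have := ylam l lk; rewrite /y ler_pdivrMr// => h.
  have -> : lam ^+ k = lam ^+ l * lam ^+ (k - l) by rewrite -exprD subnKC// ltnW.
  by rewrite -mulrA mulrCA ler_pM2l// exprn_gt0.
have Rj0 := prefix_prod_gt0 j R0; have Sj0 := prefix_prod_gt0 j S0.
have -> : lam ^+ l = lam ^+ k * lam ^+ (l - k) by rewrite -exprD subnKC.
rewrite -mulrA mulrCA ler_pM2l ?exprn_gt0//.
have := hyp j l jk; rewrite kl ln => /(_ isT).
rewrite !dims_product_prefix_prod//.
have kj0 : (0 < k - j)%N by rewrite subn_gt0.
set f : K := _ / _; have f0 : 0 <= f by rewrite divr_ge0.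
have fn : f <= n%:R.
  rewrite ler_pdivrMr ?ltr0n// -natrM ler_nat.
  by rewrite (leq_trans (leq_subr _ _))// (leq_trans ln)// leq_pmulr.
have -> : lam ^+ (l - k) = y j `^ f by rewrite lamE powR_exprn mulrC.
have Rf0 : 0 < prefix_prod R j `^ f by rewrite powR_gt0.
have yf : y j `^ f * prefix_prod R j `^ f = A `^ f * prefix_prod S j `^ f.
  rewrite -powRM ?ltW// /y divfK ?gt_eqF// powRM ?ltW//.
move=> hjl; rewrite -(ler_pM2l Rf0); apply: le_trans hjl.
have -> : prefix_prod R j `^ f * (A * (y j `^ f * prefix_prod S l)) =
    A * A `^ f * (prefix_prod S j `^ f * prefix_prod S l).
  transitivity (A * (y j `^ f * prefix_prod R j `^ f) * prefix_prod S l).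
    by ring.
  by rewrite yf; ring.
have SS0 : 0 < prefix_prod S j `^ f * prefix_prod S l.
  by rewrite mulr_gt0 ?powR_gt0// prefix_prod_gt0.
(* The exponent [f] is at most [n], which is where the power [A ^+ n.+1] comes from. *)
rewrite (ler_pM2r SS0) exprS (ler_pM2l A0).
by rewrite -powR_mulrn ?ler_powR// ltW.
Qed.

(** The product is [lam] to the power [l - k], possibly negative; multiplying by [lam ^+ k] keeps
    exponents natural. *)
Lemma prefix_prod_stretch n (lam : K) (k l : nat) : lam != 0 -> (0 < k)%N ->
  (0 < l <= n)%N ->
  prefix_prod (fun i : 'I_n => if i == 0 :> nat then lam ^- k.-1 else lam) l *
    lam ^+ k = lam ^+ l.
Proof.
move=> lam0 k0; set T := (fun i : 'I_n => _).
case: l => // l; elim: l => [|l IH] ln.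
  have h := prefix_prodS T (Ordinal ln); rewrite /= in h.
  rewrite h /prefix_prod big_pred0// mul1r /T /= -{2}(prednK k0) exprS mulrCA.
  by rewrite mulVf ?mulr1 ?expr1// expf_neq0.
have h := prefix_prodS T (Ordinal ln); rewrite /= in h.
by rewrite h mulrAC IH ?(ltnW ln)// -exprSr.
Qed.

(** An injective [f] meets index 0 at most once: the product is 1 if it does and [lam ^+ k] if it
    does not. *)
Lemma stretch_inj n k (lam : K) (f : 'I_k -> 'I_n) : 1 <= lam -> injective f ->
  1 <= \prod_i (if f i == 0 :> nat then lam ^- k.-1 else lam).
Proof.
move=> lam1 injf; have lam0 : lam != 0 by rewrite gt_eqF// (lt_le_trans ltr01).
have [/existsP[i0 /eqP fi0]|] := boolP [exists i, f i == 0 :> nat].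
  rewrite (bigD1 i0)//= fi0 eqxx (eq_bigr (fun=> lam)); last first.
    move=> i ii0; rewrite ifN//; apply: contra ii0 => /eqP fi.
    by apply/eqP/injf/val_inj; rewrite /= fi fi0.
  by rewrite prodr_const cardC1 card_ord mulVf ?expf_neq0.
rewrite negb_exists => /forallP h.
rewrite (eq_bigr (fun=> lam)) => [|i _]; last by rewrite (negbTE (h i)).
by rewrite prodr_const exprn_ege1.
Qed.

End stretching.

Theorem theorem2 (K : realType) (n : nat) (n_ge1 : (1 <= n)%N) :
  exists2 C : K, 0 < C &
  forall (k : nat) (R S : 'I_n -> K),
    (1 <= k <= n)%N -> rectangle_dims R -> rectangle_dims S ->
    (forall j l : nat, (j < k)%N -> (k <= l <= n)%N ->
       C * dims_product S k j l <= dims_product R k j l) ->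
    exists I : 'rV[K]_n -> 'rV[K]_n,
      [/\ smooth_embedding (rectangle S) I,
          I @` rectangle S `<=` rectangle R &
          k_expanding k (rectangle S) I].
Proof.
(* [A] is the loss of the folds in [embeds_of_prefix_prod]; [ex_stretch] turns it into the constant
   [A ^+ n.+1]. *)
pose A : K := 32 ^+ (n * n).
have A1 : 1 <= A by rewrite exprn_ege1// ler1n.
exists (A ^+ n.+1); first by rewrite exprn_gt0// (lt_le_trans ltr01).
move=> k R S kn Rdims [S0 _] hyp; have [R0 _] := Rdims.
have [lam lam1 hlam] := ex_stretch A1 kn R0 S0 hyp.
have lam0 : 0 < lam by exact: lt_le_trans lam1.
pose d (i : 'I_n) := if i == 0 :> nat then lam ^- k.-1 else lam.
have d0 i : 0 < d i by rewrite /d; case: ifP; rewrite ?invr_gt0 ?exprn_gt0.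
apply: embeds_k_expanding; apply: (@embeds_trans _ _ _ _ (fun i => d i * S i)).
  by apply: (embeds_diag d0) => // f; exact: stretch_inj.
apply: embeds_of_prefix_prod => // [i|l ln]; first by rewrite mulr_gt0.
have k0 : (0 < k)%N by case/andP: kn.
have e : prefix_prod d l * lam ^+ k = lam ^+ l.
  exact: prefix_prod_stretch (lt0r_neq0 lam0) k0 ln.
have := hlam l ln; rewrite -e prefix_prodM => h.
rewrite -(ler_pM2l (exprn_gt0 k lam0)); apply: le_trans h.
have E (a x y z : K) : x * (a * (y * z)) = a * (y * x * z) by ring.
by rewrite E.
Qed.
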